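(* For the modified $M^X/M/c$ queueing process with $q$-matrix $\tilde Q$: (i) the process is recurrent if and only if $B_c'(1)\le0$; (ii) the process is positive recurrent if and only if $B_c'(1)<0$ and $\mu_1<\infty$, where $\mu_1=\sum_{j=1}^\infty jh_j$.
   Context: Let $\mathbf E=\{0,1,2,\dots\}$ and let $c\ge 1$ be an integer (the number of servers). Let $(b_j)_{j\ge0}$ be reals with $b_j\ge 0$ for $j\ne 1$, $0<-b_1=\sum_{j\ne1}b_j<\infty$, $b_0>0$ and $\sum_{j\ge2}b_j>0$. Let $h_j\ge0$ ($j\ge1$) with $0<h:=\sum_{j\ge1}h_j<\infty$. The $M^X/M/c$ queue with resurrection is the continuous-time Markov chain on $\mathbf E$ with conservative bounded $q$-matrix $\tilde Q=(\tilde q_{ij})$ given by: for $i\ge1$, $\tilde q_{i,i-1}=\min(i,c)b_0$, $\tilde q_{ii}=b_1-[\min(i,c)-1]b_0$, $\tilde q_{ij}=b_{j-i+1}$ for $j\ge i+1$; $\tilde q_{00}=-h$, $\tilde q_{0j}=h_j$ for $j\ge1$; all other entries $0$. Define $B(s)=\sum_{j\ge0}b_js^j$ and $B_c(s)=B(s)+(c-1)b_0(1-s)$; $B_c'(1)\in(-\infty,\infty]$ is the (left) derivative at $1$. *)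

(* Defs.v *)
From HB Require Import structures.
From mathcomp Require Import all_boot all_order all_algebra.
From mathcomp Require Import all_classical all_reals all_analysis.

Set Implicit Arguments.
Unset Strict Implicit.
Unset Printing Implicit Defensive.

Import Order.TTheory GRing.Theory Num.Theory.
Import numFieldNormedType.Exports.

Local Open Scope classical_set_scope.
Local Open Scope ring_scope.

(* [P t i j] is the probability of moving from i to j in time t; only the
   values at t >= 0 matter.  All the series have nonnegative terms and are
   taken in [\bar R], so that no convergence is presupposed. *)
Record transition_function (R : realType) (P : R -> nat -> nat -> R) : Prop :=
  TransitionFunction {
    tf_ge0 : forall t i j, 0 <= t -> 0 <= P t i j ;
    tf_stochastic : forall t i, 0 <= t ->
      (\sum_(0 <= j <oo) (P t i j)%:E = 1)%E ;
    tf_Chapman_Kolmogorov : forall s t i j, 0 <= s -> 0 <= t ->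
      (P (s + t) i j)%:E = (\sum_(0 <= k <oo) (P s i k * P t k j)%:E)%E ;
    tf_init : forall i j, P 0 i j = (i == j)%:R ;
    tf_standard : forall i j, P t i j @[t --> 0^'+] --> ((i == j)%:R : R)
  }.

Definition has_q_matrix (R : realType) (P : R -> nat -> nat -> R)
    (Q : nat -> nat -> R) : Prop :=
  forall i j, (P t i j - P 0 i j) / t @[t --> 0^'+] --> Q i j.

(* Recurrence and positive recurrence in the classical sense for transition
   functions (Chung, Anderson): infinite expected time spent at i, and a
   nonzero limit of P t i i. *)
Definition recurrent_state (R : realType) (P : R -> nat -> nat -> R)
    (i : nat) : Prop :=
  (\int[lebesgue_measure]_(t in `[0%R, +oo[) (P t i i)%:E = +oo)%E.

Definition positive_recurrent_state (R : realType) (P : R -> nat -> nat -> R)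
    (i : nat) : Prop :=
  recurrent_state P i /\
  exists2 l : R, 0 < l & P t i i @[t --> +oo] --> l.

Definition recurrent (R : realType) (P : R -> nat -> nat -> R) : Prop :=
  forall i, recurrent_state P i.

Definition positive_recurrent (R : realType) (P : R -> nat -> nat -> R) : Prop :=
  forall i, positive_recurrent_state P i.

(* The sequence h is indexed from 1: [h 0] is never used. *)
Definition resurrection_rate (R : realType) (h : nat -> R) : \bar R :=
  (\sum_(1 <= j <oo) (h j)%:E)%E.

Definition resurrection_mean (R : realType) (h : nat -> R) : \bar R :=
  (\sum_(1 <= j <oo) (j%:R * h j)%:E)%E.

Definition queue_q_matrix (R : realType) (c : nat) (b h : nat -> R)
    (i j : nat) : R :=
  if i == 0%N then
    if j == 0%N then - fine (resurrection_rate h) else h j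
  else if j == i.-1 then (minn i c)%:R * b 0%N
  else if j == i then b 1%N - ((minn i c)%:R - 1) * b 0%N
  else if (i < j)%N then b (j - i).+1
  else 0.

Definition gen_B (R : realType) (b : nat -> R) (s : R) : R :=
  limn (series (fun j => b j * s ^+ j)).

Definition gen_Bc (R : realType) (c : nat) (b : nat -> R) (s : R) : R :=
  gen_B b s + (c%:R - 1) * b 0%N * (1 - s).

(* The left derivative of f at x is l, possibly infinite. *)
Definition is_left_derivative (R : realType) (f : R -> R) (x : R)
    (l : \bar R) : Prop :=
  ((f s - f x) / (s - x))%:E @[s --> x^'-] --> l.

(* Main.v *)
Require Import Defs.
From HB Require Import structures.
From mathcomp Require Import all_boot all_order all_algebra.
From mathcomp Require Import all_classical all_reals all_analysis.
From mathcomp Require Import measurable_realfun ring lra zify.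

Set Implicit Arguments.
Unset Strict Implicit.
Unset Printing Implicit Defensive.

Import Order.TTheory GRing.Theory Num.Theory.
Import numFieldNormedType.Exports.

Local Open Scope classical_set_scope.
Local Open Scope ring_scope.

(** Below a positive state [i] the queue can only step to [i - 1]. The net flow
    across the cut between [0, j] and [j + 1, oo) is therefore read off from
    finitely many occupation times: if [g k] is the expected time spent in [k]
    during [0, T], starting from [i], then ([cut_equation])

      delta (j+1) g (j+1) = eta (j+1) g 0 + sum_(1 <= k <= j) beta (j-k+2) g k
                            + P(X_T <= j) - [i <= j],

    where [delta k = min(k, c) b_0], and [beta], [eta] are the tails of [b] and
    [h]. This is the integrated forward equation summed over the states up to
    [j]. The q-matrix is bounded and its columns are finite, which makes the
    forward equation hold for every standard transition function with this
    q-matrix ([forward_equation]): it is the derivative at [s = 0] of the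
    identity [sum_k g_k(T) P_kj(s) = g_j(T + s) - g_j(s)].

    Both parts of the theorem compare [c b_0] with
    [sum_l beta (l+2) = sum_k (k - 1) b_k], the mean displacement by arrivals
    per unit time. Dividing [B(s)] by [1 - s], by parts, gives
    [B_c(s) / (s - 1) = sum_l beta (l+2) s^(l+1) - c b_0], so [B_c'(1)] is the
    difference of the two ([gen_Bc_left_derivative]).

    Recurrence. If [B_c'(1) > 0], then for some [s < 1] the sum of the cut
    equations with weights [s^j] bounds the time spent in state 1, uniformly in
    [T] ([occupation_one_bounded]). If [B_c'(1) <= 0] and the time spent in 0
    were bounded, the cut equations would bound the time spent in every state;
    each cut above the initial state would then carry a unit net flow upwards
    for ever, which the sum of the first [N] cuts excludes for large [N]
    ([occupation_zero_diverges]). So the time spent in 0 is infinite, and the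
    cut equations propagate this to all states.

    Positive recurrence. When the time spent in 0 diverges, the cut equations
    determine the limits [m j] of [g j / g 0] one after the other, without any
    compactness argument, and [m] satisfies them without the boundary terms
    ([occupation_ratio_cvg]). Summing these over [j] shows that [m] is summable
    if and only if [B_c'(1) < 0] and [mu_1] is finite ([cut_balanced_summable],
    [drift_lt_of_summable]). If [P t 0 0] has a positive limit, then [g 0] grows
    linearly in [T] while the [g j] add up to [T], so [m] is summable.
    Conversely [m] is subinvariant by Fatou, hence, when summable, invariant;
    then [P t i i] converges to a positive limit because the total variation
    distance to the normalized [m] strictly contracts ([tf_cvg_invariant]). *)

(** * Series with nonnegative terms *)

Lemma cvg_sum_nat (R : realType) (T : Type) (F : set_system T) {FF : Filter F}
    (f : nat -> T -> R) (l : nat -> R) m n :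
  (forall k, (m <= k < n)%N -> f k x @[x --> F] --> l k) ->
  \sum_(m <= k < n) f k x @[x --> F] --> \sum_(m <= k < n) l k.
Proof.
move=> fl; rewrite big_nat; under eq_fun do rewrite big_nat.
by apply: cvg_big => //; exact: add_continuous.
Qed.

Definition sums_to (R : realType) (a : nat -> R) (l : R) : Prop :=
  \sum_(0 <= k < n) a k @[n --> \oo] --> l.

Section SumsTo.
Variable R : realType.
Implicit Types (a b : nat -> R) (l : R).

Lemma sums_toP a l : (forall k, 0 <= a k) ->
  sums_to a l <-> (\sum_(0 <= k <oo) (a k)%:E)%E = l%:E.
Proof.
move=> a0; split=> [al|al].
  apply/cvg_lim => //.
  under eq_fun do rewrite sumEFin.
  by apply: cvg_EFin => //; exact: nearW.
have : cvgn (fun n => \sum_(0 <= i < n) (a i)%:E)%E.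
  by apply: is_cvg_nneseries => n _ _; rewrite lee_fin.
move/cvg_toP => /(_ _ al).
under eq_fun do rewrite sumEFin.
by move/fine_cvgP => [].
Qed.

Lemma sum_nat_nondecreasing a : (forall k, 0 <= a k) ->
  nondecreasing_seq (fun n => \sum_(0 <= k < n) a k).
Proof.
move=> a0; apply/nondecreasing_seqP => n.
by rewrite big_nat_recr//= lerDl.
Qed.

Lemma sums_to_ge_partial a l n : (forall k, 0 <= a k) -> sums_to a l ->
  \sum_(0 <= k < n) a k <= l.
Proof.
move=> a0 al; rewrite -(cvg_lim _ al)//.
apply: (nondecreasing_cvgn_le (sum_nat_nondecreasing a0)).
by apply/cvg_ex; exists l.
Qed.

Lemma sums_to_ge_term a l k : (forall k, 0 <= a k) -> sums_to a l -> a k <= l.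
Proof.
move=> a0 al; apply: le_trans (sums_to_ge_partial k.+1 a0 al).
by rewrite big_nat_recr//= lerDr sumr_ge0.
Qed.

Lemma sums_to_le a l K : (forall n, \sum_(0 <= k < n) a k <= K) ->
  sums_to a l -> l <= K.
Proof.
move=> aK al; rewrite -(cvg_lim _ al)//; apply: limr_le.
  by apply/cvg_ex; exists l.
by apply: nearW => n; exact: aK.
Qed.

Lemma sums_to_le_sums a b l m : (forall k, a k <= b k) ->
  sums_to a l -> sums_to b m -> l <= m.
Proof.
move=> ab al bm; apply: (ler_cvg_to al bm).
by apply: nearW => n; apply: ler_sum.
Qed.

Lemma sums_to_unique a l m : sums_to a l -> sums_to a m -> l = m.
Proof. by move=> al am; rewrite -(cvg_lim _ al)// -(cvg_lim _ am). Qed.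

Lemma sums_toZ a l (r : R) : sums_to a l -> sums_to (fun k => r * a k) (r * l).
Proof.
move=> al; rewrite /sums_to; under eq_fun do rewrite -mulr_sumr.
by apply: cvgM => //; exact: cvg_cst.
Qed.

Lemma sums_toD a b l m : sums_to a l -> sums_to b m ->
  sums_to (fun k => a k + b k) (l + m).
Proof.
move=> al bm; rewrite /sums_to; under eq_fun do rewrite big_split/=.
exact: cvgD.
Qed.

Lemma sums_toB a b l m : sums_to a l -> sums_to b m ->
  sums_to (fun k => a k - b k) (l - m).
Proof.
move=> al bm; rewrite /sums_to; under eq_fun do rewrite big_split/= sumrN.
exact: cvgB.
Qed.

Lemma sums_to_exists a K : (forall k, 0 <= a k) ->
  (forall n, \sum_(0 <= k < n) a k <= K) -> exists l, sums_to a l.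
Proof.
move=> a0 aK; apply/cvg_ex; apply: nondecreasing_is_cvgn.
  exact: sum_nat_nondecreasing.
by exists K => _ [n _ <-].
Qed.

Lemma sums_to_delta (j : nat) (x : R) : sums_to (fun k => x * (k == j)%:R) x.
Proof.
apply: cvg_near_cst; near=> n.
have jn : (j < n)%N by near: n; exact: nbhs_infty_gt.
rewrite (bigD1_seq j)/= ?iota_uniq ?mem_index_iota//= eqxx mulr1.
by rewrite big1 ?addr0// => k /negPf ->; rewrite mulr0.
Unshelve. all: by end_near.
Qed.

Lemma sums_to_interchange (a : nat -> nat -> R) (r s : nat -> R) l :
  (forall i j, 0 <= a i j) ->
  (forall i, sums_to (a i) (r i)) -> (forall j, sums_to (a ^~ j) (s j)) ->
  sums_to r l -> sums_to s l.
Proof.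
move=> a0 ar as_ rl.
have r0 i : 0 <= r i.
  exact: le_trans (a0 i 0%N) (sums_to_ge_term 0 (a0 i) (ar i)).
have s0 j : 0 <= s j.
  exact: le_trans (a0 0%N j) (sums_to_ge_term 0 (a0^~ j) (as_ j)).
apply/sums_toP => //.
transitivity (\sum_(0 <= j <oo) \sum_(0 <= i <oo) (a i j)%:E)%E.
  apply: eq_eseriesr => j _; apply/esym/sums_toP => //; exact: as_.
rewrite nneseries_interchange; last by move=> i j; rewrite lee_fin.
transitivity (\sum_(0 <= i <oo) (r i)%:E)%E; last exact/sums_toP.
apply: eq_eseriesr => i _; apply/sums_toP => //; exact: ar.
Qed.

End SumsTo.
Arguments sums_toZ [R a l] r.
Arguments sums_to_delta [R] j x.

(** * Transition functions with bounded rates *)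

Section TransitionFunction.
Variables (R : realType) (P : R -> nat -> nat -> R).
Hypothesis P_tf : transition_function P.

Lemma tf_sums_to_1 t i : 0 <= t -> sums_to (P t i) 1.
Proof.
move=> t0; apply/sums_toP; first by move=> k; exact: (tf_ge0 P_tf).
exact: (tf_stochastic P_tf).
Qed.

Lemma tf_sums_to s t i j : 0 <= s -> 0 <= t ->
  sums_to (fun k => P s i k * P t k j) (P (s + t) i j).
Proof.
move=> s0 t0; apply/sums_toP.
  by move=> k; rewrite mulr_ge0// (tf_ge0 P_tf).
exact/esym/(tf_Chapman_Kolmogorov P_tf).
Qed.

Lemma tf_le1 t i j : 0 <= t -> P t i j <= 1.
Proof.
move=> t0; have P0 k : 0 <= P t i k by exact: (tf_ge0 P_tf).
exact: (sums_to_ge_term j P0 (tf_sums_to_1 i t0)).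
Qed.

Lemma tf_mul_le s t i k j : 0 <= s -> 0 <= t ->
  P s i k * P t k j <= P (s + t) i j.
Proof.
move=> s0 t0.
have P0 l : 0 <= P s i l * P t l j by rewrite mulr_ge0// (tf_ge0 P_tf).
exact: (sums_to_ge_term k P0 (tf_sums_to s0 t0)).
Qed.

Lemma tf_offdiag_le t i j : 0 <= t -> i != j -> P t i j <= 1 - P t i i.
Proof.
move=> t0 ij; rewrite lerBrDr.
have P0 k : 0 <= P t i k by exact: (tf_ge0 P_tf).
apply: le_trans _ (sums_to_ge_partial (i + j).+1 P0 (tf_sums_to_1 i t0)).
have jm : j \in index_iota 0 (i + j).+1 by rewrite mem_index_iota; lia.
have im : i \in index_iota 0 (i + j).+1 by rewrite mem_index_iota; lia.
rewrite (bigD1_seq j jm (iota_uniq _ _))/= lerD2l (big_rem i)//= ij.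
by rewrite lerDl sumr_ge0.
Qed.

(** Staying put during each of [n] short periods has probability at least
    [P (t / n) i i ^+ n], and the factors are near 1. *)
Lemma tf_diag_gt0 t i : 0 <= t -> 0 < P t i i.
Proof.
move=> t0.
have P1 : P s i i @[s --> 0^'+] --> ((i == i)%:R : R).
  exact: (tf_standard P_tf).
rewrite eqxx in P1.
have : \forall s \near 0^'+, 0 < P s i i by exact: (cvgr_gt _ P1).
rewrite near_withinE; case/nbhs_ballP => e /= e0 Pe.
have Ps s : 0 <= s -> s < e -> 0 < P s i i.
  rewrite le_eqVlt => /predU1P[<- _|s0 se].
    by rewrite (tf_init P_tf) eqxx.
  by apply: Pe => //; rewrite /ball/= sub0r normrN gtr0_norm.
pose n := (Num.truncn (t / e)).+1.
have tn : t / n%:R < e.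
  rewrite ltr_pdivrMr ?ltr0n// mulrC -ltr_pdivrMr//; exact: truncnS_gt.
have un : 0 <= t / n%:R by rewrite divr_ge0.
have Pk k : 0 < P (t / n%:R *+ k) i i.
  elim: k => [|k IH]; first by rewrite mulr0n (tf_init P_tf) eqxx.
  rewrite mulrS; apply: lt_le_trans (tf_mul_le i i i un _).
    by rewrite mulr_gt0// Ps.
  exact: mulrn_wge0.
by have := Pk n; rewrite -mulr_natr divfK// pnatr_eq0.
Qed.

Section BoundedRates.
Variables (Q : nat -> nat -> R) (q : R).
Hypothesis P_q : has_q_matrix P Q.
Hypothesis Q_le : forall i, - Q i i <= q.

(** The exit probability [1 - P t i i] is subadditive in [t], so its slope at
    0 bounds it globally. *)
Lemma tf_exit_le t i : 0 <= t -> 1 - P t i i <= q * t.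
Proof.
move=> t0; apply/ler_addgt0Pr => eps eps0.
have [->|tn0] := eqVneq t 0.
  by rewrite (tf_init P_tf) eqxx subrr mulr0 add0r ltW.
have tp : 0 < t by rewrite lt_neqAle eq_sym tn0.
have e0 : 0 < eps / t by rewrite divr_gt0.
have : \forall s \near 0^'+, Q i i - eps / t < (P s i i - P 0 i i) / s.
  have Pq : (P s i i - P 0 i i) / s @[s --> 0^'+] --> Q i i by exact: P_q.
  by apply: (cvgr_gt _ Pq); rewrite ltrBlDr ltrDl.
rewrite near_withinE; case/nbhs_ballP => e /= ep Pe.
pose n := (Num.truncn (t / e)).+1.
pose s := t / n%:R.
have n0 : 0 < n%:R :> R by rewrite ltr0n.
have s0 : 0 < s by rewrite divr_gt0.
have se : s < e.
  by rewrite ltr_pdivrMr// mulrC -ltr_pdivrMr//; exact: truncnS_gt.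
have Ps : 1 - P s i i <= (q + eps / t) * s.
  have := Pe s; rewrite /ball/= sub0r normrN gtr0_norm// => /(_ se s0).
  rewrite (tf_init P_tf) eqxx ltr_pdivlMr//.
  have : - Q i i * s <= q * s by rewrite ler_pM2r.
  by rewrite !mulrDl !mulNr /=; lra.
have Pk k : 1 - P (s *+ k) i i <= ((q + eps / t) * s) *+ k.
  elim: k => [|k IH]; first by rewrite !mulr0n (tf_init P_tf) eqxx subrr.
  have sk : 0 <= s *+ k by rewrite mulrn_wge0// ltW.
  have := tf_mul_le i i i (ltW s0) sk; rewrite -mulrS.
  have := tf_le1 i i (ltW s0); have := tf_le1 i i sk.
  rewrite [_ * s *+ _]mulrS.
  move: Ps IH; set A := (q + _) * s; set B := A *+ k.
  set u := P s i i; set v := P (s *+ k) i i => uA vB v1 u1 uv.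
  have : 0 <= (1 - u) * (1 - v) by rewrite mulr_ge0// subr_ge0.
  rewrite mulrBr !mulrBl !mul1r mulr1; lra.
have := Pk n; rewrite -[s *+ n]mulr_natr /s divfK ?gt_eqF//.
rewrite -[X in _ <= X -> _]mulr_natr -mulrA divfK ?gt_eqF// mulrDl divfK//.
Qed.

Lemma tf_dist_le s t i j : 0 <= s -> 0 <= t ->
  `|P (t + s) i j - P t i j| <= q * s.
Proof.
move=> s0 t0; have E := tf_exit_le i s0.
apply: le_trans E.
have lo := tf_mul_le i i j s0 t0; rewrite (addrC t s).
have P1 := tf_le1 i j t0; have P0 := tf_ge0 P_tf i j t0.
have Q1 := tf_le1 i i s0.
suff up : P (s + t) i j <= P t i j + (1 - P s i i).
  by rewrite ler_distl; apply/andP; split; nra.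
(* In the Chapman-Kolmogorov sum the states other than [i] contribute at most
   the mass that left [i], and [i] itself at most [P t i j]. *)
have S1 : sums_to (fun k => P s i k + P t i j * (k == i)%:R
                    - P s i i * (k == i)%:R) (1 + P t i j - P s i i).
  apply: sums_toB; last exact: sums_to_delta.
  by apply: sums_toD; [exact: tf_sums_to_1|exact: sums_to_delta].
have -> : P t i j + (1 - P s i i) = 1 + P t i j - P s i i by lra.
apply: sums_to_le_sums (tf_sums_to s0 t0) S1 => k.
have := tf_ge0 P_tf i k s0; have := tf_le1 k j t0.
have := tf_ge0 P_tf k j t0.
by have [->|_] := eqVneq k i; rewrite ?mulr1 ?mulr0; nra.
Qed.

End BoundedRates.
End TransitionFunction.
Arguments tf_sums_to [R P] P_tf [s t] i j.
Arguments tf_sums_to_1 [R P] P_tf [t] i.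

(** * Occupation times *)

Lemma integral_shift (R : realType) (G : R -> R) (a b s : R) : a <= b ->
  continuous G ->
  (\int[lebesgue_measure]_(x in `[(a + s)%R, (b + s)%R]) (G x)%:E =
   \int[lebesgue_measure]_(x in `[a, b]) (G (x + s)%R)%:E)%E.
Proof.
move=> ab cG.
have dF (x : R) : is_derive x 1 (fun y : R => y + s) 1.
  by apply: is_derive_eq; rewrite addr0.
have F'E : derive1 (fun y : R => y + s) = cst 1.
  by apply/funext => x; rewrite derive1E derive_val.
have cF : continuous (fun y : R => y + s).
  by move=> x; apply: cvgD; [exact: cvg_id|exact: cvg_cst].
rewrite (@integration_by_substitution_increasing _ (fun y : R => y + s))//.
- by rewrite F'E; apply: eq_integral => x _ /=; rewrite mulr1.
- by move=> x y _ _; rewrite ltrD2r.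
- by rewrite F'E => x _; exact: cvg_cst.
- by rewrite F'E; exact: is_cvg_cst.
- by rewrite F'E; exact: is_cvg_cst.
- split; [by move=> x _; exact: ex_derive| |].
  + by apply: cvg_at_right_filter; exact: cF.
  + by apply: cvg_at_left_filter; exact: cF.
- by apply: continuous_subspaceT.
Qed.

Definition occupation (R : realType) (P : R -> nat -> nat -> R) (i j : nat)
    (T : R) : R :=
  \int[lebesgue_measure]_(t in `[0, T]) P t i j.

Section Occupation.
Variables (R : realType) (P : R -> nat -> nat -> R).
Variables (Q : nat -> nat -> R) (q : R).
Hypotheses (P_tf : transition_function P) (P_q : has_q_matrix P Q).
Hypothesis Q_le : forall i, - Q i i <= q.
Notation mu := lebesgue_measure.
Notation occ := (occupation P).

(** Reflecting time makes the entries continuous on the whole line, which is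
    the form in which the integration theorems apply to them. *)
Lemma tf_abs_continuous i j : continuous (fun t : R => P `|t| i j).
Proof.
have q0 : 0 <= q.
  have := tf_exit_le P_tf P_q Q_le 0 (@ler01 R); rewrite mulr1.
  by apply: le_trans; rewrite subr_ge0 (tf_le1 P_tf).
have L (x y : R) : 0 <= x -> 0 <= y -> `|P x i j - P y i j| <= q * `|x - y|.
  wlog xy : x y / x <= y => [W x0 y0|x0 y0].
    have [|/ltW] := leP x y; first by move=> ?; exact: W.
    by move=> ?; rewrite distrC [X in _ * X]distrC; exact: W.
  have := tf_dist_le P_tf P_q Q_le i j (s := y - x) (t := x).
  rewrite subr_ge0 (addrC x) subrK distrC => /(_ xy x0) H.
  by rewrite [X in _ * X]distrC (ger0_norm (x := y - x)) ?subr_ge0.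
move=> x; apply/cvgrPdist_le => /= e e0; near=> y.
apply: le_trans (L _ _ (normr_ge0 _) (normr_ge0 _)) _.
apply: (@le_trans _ _ (q * `|x - y|)).
  by rewrite ler_wpM2l// ler_dist_dist.
apply: (@le_trans _ _ ((q + 1) * `|x - y|)).
  by rewrite ler_wpM2r// lerDl.
rewrite -ler_pdivlMl ?ltr_wpDl//.
near: y; apply: cvgr_dist_le; first exact: cvg_id.
by rewrite mulr_gt0// invr_gt0 ltr_wpDl.
Unshelve. all: by end_near.
Qed.

Lemma occupation_integrable i j (a b : R) : 0 <= a ->
  mu.-integrable `[a, b] (fun t => (P t i j)%:E).
Proof.
move=> a0.
have H : mu.-integrable `[a, b] (EFin \o (fun t : R => P `|t| i j)).
  apply: continuous_compact_integrable; first exact: segment_compact.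
  by apply: continuous_subspaceT; exact: tf_abs_continuous.
apply: (eq_integrable _ _ _ _ H); first exact: measurable_itv.
move=> t; rewrite inE/= in_itv/= => /andP[at_ _].
by rewrite ger0_norm// (le_trans a0).
Qed.

Lemma occupation_measurable i j (a b : R) : 0 <= a ->
  measurable_fun `[a, b] (EFin \o (fun t => P t i j)).
Proof.
by move=> a0; have /measurable_int := occupation_integrable i j b a0.
Qed.

Lemma occupationE i j T :
  (occ i j T)%:E = (\int[mu]_(t in `[0%R, T]) (P t i j)%:E)%E.
Proof.
rewrite /occupation /Rintegral fineK//; apply: integrable_fin_num.
  exact: measurable_itv.
exact: occupation_integrable.
Qed.

Lemma occupation_ge0 i j T : 0 <= occ i j T.
Proof.
apply: Rintegral_ge0 => t /=; rewrite in_itv/= => /andP[t0 _].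
exact: (tf_ge0 P_tf).
Qed.

Lemma occupationB i j (a b : R) : 0 <= a -> a <= b ->
  ((occ i j b - occ i j a)%R%:E = \int[mu]_(t in `[a, b]) (P t i j)%:E)%E.
Proof.
move=> a0 ab; rewrite /occupation Rintegral_itvB ?bnd_simp//; last first.
  exact: occupation_integrable.
rewrite Rintegral_itv_obnd_cbnd; last first.
  apply: (integrableS _ _ _ (occupation_integrable i j b a0)) => //.
  by apply: subset_itvr; rewrite bnd_simp.
rewrite /Rintegral fineK//; apply: integrable_fin_num => //.
exact: occupation_integrable.
Qed.

Lemma integral_itv_cst (a b v : R) : a <= b ->
  (\int[mu]_(t in `[a, b]) (cst v%:E) t = (v * (b - a))%R%:E)%E.
Proof.
move=> ab; rewrite integral_cst//= lebesgue_measure_itv/= lte_fin.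
move: ab; rewrite le_eqVlt => /predU1P[->|ab].
  by rewrite ltxx subrr mulr0 mule0.
by rewrite ab EFinM EFinB.
Qed.

Lemma occupation_increment_ge i j (a b v : R) : 0 <= a -> a <= b -> 0 <= v ->
  (forall t, a <= t -> t <= b -> v <= P t i j) ->
  v * (b - a) <= occ i j b - occ i j a.
Proof.
move=> a0 ab v0 vP; rewrite -lee_fin occupationB// -integral_itv_cst//.
apply: ge0_le_integral => //.
- exact: occupation_measurable.
- by move=> t /=; rewrite in_itv/= => /andP[ta tb]; rewrite lee_fin vP.
Qed.

Lemma occupation_increment_le i j (a b v : R) : 0 <= a -> a <= b ->
  (forall t, a <= t -> t <= b -> P t i j <= v) ->
  occ i j b - occ i j a <= v * (b - a).
Proof.
move=> a0 ab Pv; rewrite -lee_fin occupationB// -integral_itv_cst//.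
apply: ge0_le_integral => //.
- move=> t /=; rewrite in_itv/= => /andP[ta tb].
  by rewrite lee_fin (tf_ge0 P_tf)// (le_trans a0).
- exact: occupation_measurable.
- by move=> t /=; rewrite in_itv/= => /andP[ta tb]; rewrite lee_fin Pv.
Qed.

Lemma occupation0 i j : occ i j 0 = 0.
Proof. by rewrite /occupation set_itv1 Rintegral_set1. Qed.

Lemma occupation_nondecreasing i j (a b : R) : 0 <= a -> a <= b ->
  occ i j a <= occ i j b.
Proof.
move=> a0 ab; rewrite -subr_ge0.
have := @occupation_increment_ge i j a b 0 a0 ab (lexx 0).
rewrite mul0r; apply => t ta tb; apply: (tf_ge0 P_tf); exact: le_trans ta.
Qed.

(** The first-order expansion of the occupation time, from the Lipschitz
    continuity of the transition function. *)
Lemma occupation_expansion i j (a s : R) : 0 <= a -> 0 <= s ->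
  `|occ i j (a + s) - occ i j a - P a i j * s| <= q * s ^+ 2.
Proof.
move=> a0 s0.
have aas : a <= a + s by rewrite lerDl.
have D t : a <= t -> t <= a + s -> `|P t i j - P a i j| <= q * s.
  move=> at_ tas; have tas0 : 0 <= t - a by rewrite subr_ge0.
  have := tf_dist_le P_tf P_q Q_le i j tas0 a0; rewrite subrKC => /le_trans.
  apply; have := tf_exit_le P_tf P_q Q_le i (@ler01 R).
  have := tf_le1 P_tf i i (@ler01 R); nra.
have qs : 0 <= q * s by apply: le_trans (D a _ _).
have sE : a + s - a = s by rewrite addrC addKr.
rewrite ler_distl; apply/andP; split.
- have [Pqs|/ltW Pqs] := leP 0 (P a i j - q * s).
    have := @occupation_increment_ge i j a (a + s) (P a i j - q * s) a0 aas Pqs.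
    rewrite sE => H; rewrite expr2; apply: le_trans (H _).
      by rewrite mulrBl mulrA.
    by move=> t ta tb; have := D t ta tb; rewrite ler_distl => /andP[].
  apply: (@le_trans _ _ 0).
    by rewrite expr2 mulrA -mulrBl mulr_le0_ge0.
  by rewrite subr_ge0 occupation_nondecreasing.
- have := @occupation_increment_le i j a (a + s) (P a i j + q * s) a0 aas.
  rewrite sE => H; rewrite expr2; apply: le_trans (H _) _.
    by move=> t ta tb; have := D t ta tb; rewrite ler_distl => /andP[].
  by rewrite mulrDl mulrA.
Qed.

Lemma occupation_sums_to i T : 0 <= T -> sums_to (fun k => occ i k T) T.
Proof.
move=> T0; apply/sums_toP; first by move=> k; exact: occupation_ge0.
under eq_eseriesr do rewrite occupationE.
rewrite -integral_nneseries//.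
- transitivity (\int[mu]_(t in `[0%R, T]) (cst 1%:E) t)%E.
    apply: eq_integral => t; rewrite inE/= in_itv/= => /andP[t0 _].
    exact: (tf_stochastic P_tf).
  by rewrite integral_itv_cst// mul1r subr0.
- by move=> k; exact: occupation_measurable.
- move=> k t /=; rewrite in_itv/= => /andP[t0 _].
  by rewrite lee_fin (tf_ge0 P_tf).
Qed.

(** Integrate the Chapman-Kolmogorov equation over the first of the two
    times. *)
Lemma occupation_shift i j (s T : R) : 0 <= s -> 0 <= T ->
  sums_to (fun k => occ i k T * P s k j) (occ i j (T + s) - occ i j s).
Proof.
move=> s0 T0; apply/sums_toP.
  by move=> k; rewrite mulr_ge0 ?occupation_ge0// (tf_ge0 P_tf).
have sTs : s <= T + s by rewrite lerDr.
rewrite occupationB//.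
transitivity (\int[mu]_(t in `[0%R, T])
   \sum_(0 <= k <oo) ((P t i k)%:E * (P s k j)%:E))%E.
  rewrite integral_nneseries//.
  - apply: eq_eseriesr => k _; rewrite EFinM occupationE ge0_integralZr//.
    + exact: occupation_measurable.
    + move=> t /=; rewrite in_itv/= => /andP[t0 _].
      by rewrite lee_fin (tf_ge0 P_tf).
    + by rewrite lee_fin (tf_ge0 P_tf).
  - move=> k.
    apply: (eq_measurable_fun (fun t => (P s k j)%:E * (P t i k)%:E)%E).
      by move=> t _; rewrite muleC.
    by apply: measurable_funeM; exact: occupation_measurable.
  - move=> k t /=; rewrite in_itv/= => /andP[t0 _].
    by rewrite mule_ge0// lee_fin (tf_ge0 P_tf).
transitivity (\int[mu]_(t in `[0%R, T]) (P `|(t + s)%R|%R i j)%:E)%E.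
  apply: eq_integral => t; rewrite inE/= in_itv/= => /andP[t0 _].
  by rewrite ger0_norm ?addr_ge0// (tf_Chapman_Kolmogorov P_tf).
rewrite -(@integral_shift _ (fun t => P `|t| i j))//; last first.
  exact: tf_abs_continuous.
rewrite add0r; apply: eq_integral => t; rewrite inE/= in_itv/= => /andP[st _].
by rewrite ger0_norm// (le_trans s0).
Qed.

Lemma occupation_le_total i j T :
  ((occ i j T)%:E <= \int[mu]_(t in `[0%R, +oo[) (P t i j)%:E)%E.
Proof.
rewrite occupationE; apply: ge0_subset_integral => //.
- apply: (@eq_measurable_fun _ _ _ _ _ (EFin \o (fun t : R => P `|t| i j))).
    by move=> t; rewrite inE/= in_itv/= andbT => t0; rewrite ger0_norm.
  apply/measurable_EFinP.
  apply: measurable_funS (continuous_measurable_fun _) => //.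
  exact: tf_abs_continuous.
- by move=> t /=; rewrite in_itv/= andbT => t0; rewrite lee_fin (tf_ge0 P_tf).
- by apply: subset_itvl; rewrite bnd_simp.
Qed.

Lemma total_occupation_le i j K : (forall T, 0 <= T -> occ i j T <= K) ->
  (\int[mu]_(t in `[0%R, +oo[) (P t i j)%:E <= K%:E)%E.
Proof.
move=> occK.
have -> : `[0%R, +oo[%classic = \bigcup_n `[0%R, n%:R : R]%classic.
  apply/seteqP; split => t /=.
    rewrite in_itv/= andbT => t0; exists (Num.truncn t).+1 => //=.
    by rewrite in_itv/= t0 ltW// truncnS_gt.
  by move=> [n _] /=; rewrite !in_itv/= andbT => /andP[].
have C : (\int[mu]_(t in `[0%R, n%:R]) (P t i j)%:E)%E @[n --> \oo] -->
    (\int[mu]_(t in \bigcup_n `[0%R, n%:R : R]%classic) (P t i j)%:E)%E.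
  apply: ge0_nondecreasing_set_cvg_integral => //.
  - move=> m n mn; rewrite subsetEset; apply: subset_itvl.
    by rewrite bnd_simp ler_nat.
  - by move=> n; exact: occupation_measurable.
  - move=> n t /=; rewrite in_itv/= => /andP[t0 _].
    by rewrite lee_fin (tf_ge0 P_tf).
rewrite -(cvg_lim _ C)//; apply: lime_le.
  by apply/cvg_ex; eexists; exact: C.
apply: nearW => n; by rewrite -occupationE lee_fin occK.
Qed.

End Occupation.
Arguments occupation_sums_to [R P Q q] P_tf P_q Q_le i [T].
Arguments occupation_shift [R P Q q] P_tf P_q Q_le i j [s T].

(** * The integrated forward equation *)

Lemma sums_to_tail_bounds (R : realType) (a v : nat -> R) (l m : R) (N : nat) :
  (forall k, (N <= k)%N -> 0 <= a k <= v k) -> sums_to a l -> sums_to v m ->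
  0 <= l - \sum_(0 <= k < N) a k <= m - \sum_(0 <= k < N) v k.
Proof.
move=> av al vm.
have split_at (w : nat -> R) n : (N <= n)%N ->
    \sum_(0 <= k < n) w k = \sum_(0 <= k < N) w k + \sum_(N <= k < n) w k.
  by move=> Nn; rewrite (big_cat_nat (leq0n N) Nn).
apply/andP; split.
- rewrite subr_ge0; apply: (cvgr_to_ge al); near=> n.
  have Nn : (N <= n)%N by near: n; exact: nbhs_infty_ge.
  rewrite (split_at a n Nn) lerDl big_nat sumr_ge0// => k /andP[Nk _].
  by have /andP[] := av _ Nk.
- suff : l - m <= \sum_(0 <= k < N) a k - \sum_(0 <= k < N) v k by lra.
  apply: (cvgr_to_le (cvgB al vm)) => /=.
  near=> n; have Nn : (N <= n)%N by near: n; exact: nbhs_infty_ge.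
  rewrite !fctE (split_at a n Nn) (split_at v n Nn).
  have : \sum_(N <= k < n) a k <= \sum_(N <= k < n) v k.
    rewrite big_nat [leRHS]big_nat; apply: ler_sum => k /andP[Nk _].
    by have /andP[] := av _ Nk.
  lra.
Unshelve. all: by end_near.
Qed.

Section Forward.
Variables (R : realType) (P : R -> nat -> nat -> R).
Variables (Q : nat -> nat -> R) (q : R).
Hypotheses (P_tf : transition_function P) (P_q : has_q_matrix P Q).
Hypothesis Q_le : forall i, - Q i i <= q.
Hypothesis Q_skip_free : forall k j, (j.+1 < k)%N -> Q k j = 0.
Notation occ := (occupation P).

Let q_ge0 : 0 <= q.
Proof.
have := tf_exit_le P_tf P_q Q_le 0 (@ler01 R); rewrite mulr1.
by apply: le_trans; rewrite subr_ge0 (tf_le1 P_tf).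
Qed.

(** The left-hand side of [occupation_shift], differentiated at [s = 0]: the
    two end points of the time interval contribute. *)
Lemma occupation_second_difference_cvg i j T : 0 <= T ->
  (occ i j (T + s) - occ i j s - occ i j T) / s @[s --> 0^'+] -->
    P T i j - (i == j)%:R.
Proof.
move=> T0; have q0 := q_ge0; apply/cvgrPdist_le => e e0.
near=> s.
have s0 : 0 < s by near: s; exact: nbhs_right_gt.
have sq : (2 * q + 1) * s <= e.
  rewrite -ler_pdivlMl; last by lra.
  near: s; apply: nbhs_right_le; rewrite mulr_gt0// invr_gt0; lra.
have := occupation_expansion P_tf P_q Q_le i j T0 (ltW s0).
have := occupation_expansion P_tf P_q Q_le i j (lexx 0) (ltW s0).
rewrite occupation0 add0r (tf_init P_tf) => H0 HT.
rewrite -(ler_pM2r s0) -[X in _ * X <= _](gtr0_norm s0) -normrM.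
rewrite mulrBl divfK ?lt0r_neq0//.
have qs2 : 2 * (q * s ^+ 2) <= e * s.
  rewrite expr2 !mulrA ler_pM2r//; nra.
move: H0 HT; rewrite !ler_distl => /andP[H1 H2] /andP[H3 H4].
rewrite mulrBl; apply/andP; split; lra.
Unshelve. all: by end_near.
Qed.

(** Only finitely many states jump to [j], but passing to the limit in the
    infinite sum needs domination: for [k > j] the difference quotient of
    [P _ k j] is bounded by [q], and the weights [occ i k T] are summable. *)
Lemma forward_equation i j T : 0 <= T ->
  P T i j - (i == j)%:R = \sum_(0 <= k < j.+2) occ i k T * Q k j.
Proof.
move=> T0.
pose C := \sum_(0 <= k < j.+2) occ i k T * Q k j.
pose X := P T i j - (i == j)%:R.
have bounds N : (j.+2 <= N)%N ->
    0 <= X - C <= q * (T - \sum_(0 <= k < N) occ i k T).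
  move=> jN.
  pose x s := (occ i j (T + s) - occ i j s - occ i j T) / s.
  pose y s := \sum_(0 <= k < N) occ i k T * ((P s k j - P 0 k j) / s).
  have xX : x s @[s --> 0^'+] --> X by exact: occupation_second_difference_cvg.
  have yC : y s @[s --> 0^'+] --> C.
    have -> : C = \sum_(0 <= k < N) occ i k T * Q k j.
      rewrite (big_cat_nat (leq0n _) jN)//= [X in _ = _ + X]big_nat.
      rewrite [X in _ = _ + X]big1 ?addr0// => k /andP[jk _].
      by rewrite Q_skip_free// mulr0.
    by apply: cvg_sum_nat => k _; apply: cvgM; [exact: cvg_cst|exact: P_q].
  have xy : \forall s \near 0^'+,
      0 <= x s - y s <= q * (T - \sum_(0 <= k < N) occ i k T).
    near=> s.
    have s0 : 0 < s by near: s; exact: nbhs_right_gt.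
    have S1 : sums_to (fun k => occ i k T * (P s k j - P 0 k j)) (x s * s).
      rewrite /x divfK ?lt0r_neq0//.
      have D := sums_toB
        (occupation_shift P_tf P_q Q_le i j (ltW s0) T0)
        (sums_to_delta j (occ i j T)).
      apply: cvg_trans D; apply: near_eq_cvg; near=> n => /=.
      apply: eq_bigr => k _; rewrite (tf_init P_tf) mulrBr.
      by have [->|] := eqVneq k j; rewrite ?mulr0.
    have S2 := sums_toZ (q * s) (occupation_sums_to P_tf P_q Q_le i T0).
    have := sums_to_tail_bounds (N := N) _ S1 S2.
    have -> : \sum_(0 <= k < N) occ i k T * (P s k j - P 0 k j) = y s * s.
      rewrite /y mulr_suml; apply: eq_bigr => k _.
      by rewrite -mulrA divfK ?lt0r_neq0.
    rewrite -mulrBl -mulr_sumr -mulrBr pmulr_lge0// mulrAC ler_pM2r//; apply.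
    move=> k Nk; have kj : k != j by lia.
    have := tf_offdiag_le P_tf (ltW s0) kj.
    have := tf_exit_le P_tf P_q Q_le k (ltW s0).
    have := tf_ge0 P_tf k j (ltW s0).
    have := occupation_ge0 P_tf i k T.
    rewrite (tf_init P_tf) (negPf kj) subr0 => o0 p0 pq pk.
    rewrite mulr_ge0//= mulrC ler_wpM2r//; lra.
  apply/andP; split.
    apply: (cvgr_to_ge (cvgB xX yC)).
    by apply: filterS xy => s /andP[].
  apply: (cvgr_to_le (cvgB xX yC)).
  by apply: filterS xy => s /andP[].
have /andP[XC _] := bounds _ (leqnn _).
apply/eqP; rewrite -subr_eq0 -/C -/X eq_le XC andbT.
rewrite -(mulr0 q) -(subrr T).
have TT : q * (T - \sum_(0 <= k < N) occ i k T) @[N --> \oo] --> q * (T - T).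
  apply: cvgM; first exact: cvg_cst.
  apply: cvgB; first exact: cvg_cst.
  exact: (occupation_sums_to P_tf P_q Q_le).
apply: (cvgr_to_ge TT); near=> N.
have jN : (j.+2 <= N)%N by near: N; exact: nbhs_infty_ge.
by have /andP[] := bounds _ jN.
Unshelve. all: by end_near.
Qed.

End Forward.

(** * Convergence to an invariant probability measure *)

Section Ergodic.
Variables (R : realType) (P : R -> nat -> nat -> R).
Hypothesis P_tf : transition_function P.

Lemma tf_gt0_of_rate (Q : nat -> nat -> R) i j t : has_q_matrix P Q ->
  i != j -> 0 < Q i j -> 0 < t -> 0 < P t i j.
Proof.
move=> P_q ij Qij t0.
have Pq : (P s i j - P 0 i j) / s @[s --> 0^'+] --> Q i j by exact: P_q.
near (0 : R)^'+ => s.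
have s0 : 0 < s by near: s; exact: nbhs_right_gt.
have st : s <= t by near: s; exact: nbhs_right_le.
have Ps : 0 < P s i j.
  have : 0 < (P s i j - P 0 i j) / s by near: s; exact: (cvgr_gt _ Pq).
  by rewrite (tf_init P_tf) (negPf ij) subr0 pmulr_lgt0// invr_gt0.
have ts : 0 <= t - s by rewrite subr_ge0.
have := tf_mul_le P_tf i j j (ltW s0) ts; rewrite subrKC.
by apply: lt_le_trans; rewrite mulr_gt0// (tf_diag_gt0 P_tf).
Unshelve. all: by end_near.
Qed.

(** A stochastic matrix preserves the total mass [M] of [m], so that no
    inequality [m P <= m] between the entries can be strict. *)
Lemma subinvariant_invariant (m : nat -> R) (M t : R) : 0 <= t ->
  (forall k, 0 <= m k) -> sums_to m M ->
  (forall j N, \sum_(0 <= k < N) m k * P t k j <= m j) ->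
  forall j, sums_to (fun k => m k * P t k j) (m j).
Proof.
move=> t0 m0 mM sub j.
have mP0 k l : 0 <= m k * P t k l by rewrite mulr_ge0// (tf_ge0 P_tf).
have /choice[u uE] l : exists u, sums_to (fun k => m k * P t k l) u.
  by apply: (sums_to_exists _ (sub l)) => k.
have um l : u l <= m l by exact: sums_to_le (sub l) (uE l).
have uM : sums_to u M.
  apply: (sums_to_interchange (a := fun k l => m k * P t k l) _ _ uE mM) => //.
  move=> k; rewrite -[X in sums_to _ X]mulr1; apply: sums_toZ.
  exact: (tf_sums_to_1 P_tf).
have d0 : sums_to (fun l => m l - u l) 0.
  by rewrite -(subrr M); exact: sums_toB.
have : m j - u j <= 0.
  by apply: (sums_to_ge_term j _ d0) => l; rewrite subr_ge0.
rewrite subr_le0 => mu; suff -> : m j = u j by exact: uE.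
by apply/eqP; rewrite eq_le mu um.
Qed.

Variable p : nat -> R.
Hypothesis p_gt0 : forall k, 0 < p k.
Hypothesis p_sum : sums_to p 1.
Hypothesis p_invariant : forall t j, 0 <= t ->
  sums_to (fun k => p k * P t k j) (p j).
Hypothesis P_gt0 : forall k, 0 < P 1 k 0%N.

Section From.
Variable i : nat.

Let excess t k : R := Num.max (P t i k - p k) 0.
Let deficit t k : R := Num.max (p k - P t i k) 0.

Let excess_ge0 t k : 0 <= excess t k.
Proof. by rewrite le_max lexx orbT. Qed.

Let deficit_ge0 t k : 0 <= deficit t k.
Proof. by rewrite le_max lexx orbT. Qed.

Let excessB t k : excess t k - deficit t k = P t i k - p k.
Proof.
rewrite /excess /deficit; case: (leP (P t i k) (p k)) => Pp.
  rewrite max_r ?subr_le0// max_l ?subr_ge0//; lra.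
by rewrite max_l ?subr_ge0 ?ltW// max_r ?subr_le0 ?ltW// subr0.
Qed.

(** Invariance gives [p i * P t i k <= p k]: seen from [i], the law at any
    time is dominated by a fixed multiple of [p], which is what prevents mass
    from escaping to infinity. *)
Let tf_le_invariant t k : 0 <= t -> P t i k <= (p i)^-1 * p k.
Proof.
move=> t0; rewrite ler_pdivlMl//.
apply: (sums_to_ge_term (a := fun l => p l * P t l k) i _
  (@p_invariant t k t0)) => l.
by rewrite mulr_ge0 ?(tf_ge0 P_tf)// ltW.
Qed.

Let p_le1 k : p k <= 1.
Proof. by apply: (sums_to_ge_term k _ p_sum) => l; exact: ltW. Qed.

Let excess_le t k : 0 <= t -> excess t k <= (p i)^-1 * p k.
Proof.
move=> t0; rewrite ge_max; apply/andP; split.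
  apply: le_trans (tf_le_invariant k t0); rewrite gerBl; exact: ltW.
by rewrite mulr_ge0 ?invr_ge0 ?ltW.
Qed.

Let deficit_le t k : 0 <= t -> deficit t k <= (p i)^-1 * p k.
Proof.
move=> t0; rewrite ge_max; apply/andP; split; last first.
  by rewrite mulr_ge0 ?invr_ge0 ?ltW.
apply: (@le_trans _ _ (p k)).
  by rewrite gerBl (tf_ge0 P_tf).
by rewrite ler_peMl ?(ltW (p_gt0 k))// invf_ge1// p_le1.
Qed.

(** Half of the [l1] distance between the law at time [t] and [p]. *)
Let D t : R := lim (\sum_(0 <= k < n) excess t k @[n --> \oo]).

Let D_excess t : 0 <= t -> sums_to (excess t) (D t).
Proof.
move=> t0.
have [l El] : exists l, sums_to (excess t) l.
  apply: (@sums_to_exists _ _ ((p i)^-1)) => // n.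
  apply: (@le_trans _ _ (\sum_(0 <= k < n) (p i)^-1 * p k)).
    by apply: ler_sum => k _; exact: excess_le.
  rewrite -mulr_sumr; apply: ler_piMr; first by rewrite invr_ge0 ltW.
  by apply: (sums_to_ge_partial n _ p_sum) => k; exact: ltW.
by rewrite /D; apply/cvg_ex; exists l.
Qed.

Let D_deficit t : 0 <= t -> sums_to (deficit t) (D t).
Proof.
move=> t0.
have := sums_toB (D_excess t0) (sums_toB (tf_sums_to_1 P_tf i t0) p_sum).
rewrite subrr subr0; apply: cvg_trans; apply: near_eq_cvg; near=> n => /=.
by apply: eq_bigr => k _; rewrite -excessB; lra.
Unshelve. all: by end_near.
Qed.

(** Excess and deficit mass that both reach state 0 cancel. *)
Let D_step t s : 0 <= t -> 0 <= s -> exists x y, [/\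
  sums_to (fun k => excess t k * P s k 0%N) x,
  sums_to (fun k => deficit t k * P s k 0%N) y &
  D (t + s) + Num.min x y <= D t].
Proof.
move=> t0 s0.
have flow (a : nat -> R) : (forall k, 0 <= a k) -> sums_to a (D t) ->
    exists2 x, (forall j, sums_to (fun k => a k * P s k j) (x j)) &
      sums_to x (D t).
  move=> a0 aD.
  have aP0 k j : 0 <= a k * P s k j by rewrite mulr_ge0// (tf_ge0 P_tf).
  have /choice[x xE] j : exists x, sums_to (fun k => a k * P s k j) x.
    apply: (@sums_to_exists _ _ (D t)) => // n.
    apply: (@le_trans _ _ (\sum_(0 <= k < n) a k)).
      by apply: ler_sum => k _; rewrite ler_piMr// (tf_le1 P_tf).
    exact: (sums_to_ge_partial n a0 aD).
  exists x => //; apply: (sums_to_interchange aP0 _ xE aD) => k.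
  rewrite -[X in sums_to _ X]mulr1; apply: sums_toZ.
  exact: (tf_sums_to_1 P_tf).
have [x xE xD] := flow _ (excess_ge0 t) (D_excess t0).
have [y yE _] := flow _ (deficit_ge0 t) (D_deficit t0).
exists (x 0%N), (y 0%N); split => //.
have x0 j : 0 <= x j.
  apply: (le_trans _ (sums_to_ge_term 0 _ (xE j))) => [|k].
    by rewrite mulr_ge0// (tf_ge0 P_tf).
  by rewrite mulr_ge0// (tf_ge0 P_tf).
have y0 j : 0 <= y j.
  apply: (le_trans _ (sums_to_ge_term 0 _ (yE j))) => [|k].
    by rewrite mulr_ge0// (tf_ge0 P_tf).
  by rewrite mulr_ge0// (tf_ge0 P_tf).
have xy j : P (t + s) i j - p j = x j - y j.
  apply: sums_to_unique
    (sums_toB (tf_sums_to P_tf i j t0 s0) (@p_invariant s j s0)) _.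
  have := sums_toB (xE j) (yE j).
  apply: cvg_trans; apply: near_eq_cvg; near=> n => /=.
  by apply: eq_bigr => k _; rewrite -!mulrBl excessB.
have ts0 : 0 <= t + s by exact: addr_ge0.
have S := sums_toD (D_excess ts0) (sums_to_delta 0 (Num.min (x 0%N) (y 0%N))).
apply: sums_to_le_sums S xD => k; rewrite /excess xy.
have [->|_] := eqVneq k 0%N; rewrite ?mulr1 ?mulr0 ?addr0.
  case: (leP (x 0%N) (y 0%N)) => xy0.
    by rewrite max_r ?subr_le0// add0r.
  by rewrite max_l ?subr_ge0 ?(ltW xy0)// subrK.
by rewrite ge_max x0 andbT gerBl y0.
Unshelve. all: by end_near.
Qed.

Let D_ge0 t : 0 <= t -> 0 <= D t.
Proof.
by move=> t0; apply: le_trans (sums_to_ge_term 0 _ (D_excess t0)).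
Qed.

Let D_nonincreasing t s : 0 <= t -> 0 <= s -> D (t + s) <= D t.
Proof.
move=> t0 s0; have [x [y [xE yE]]] := D_step t0 s0.
apply: le_trans; rewrite lerDl le_min; apply/andP; split.
  apply: (le_trans _ (sums_to_ge_term 0 _ xE)) => [|k];
    by rewrite mulr_ge0// (tf_ge0 P_tf).
apply: (le_trans _ (sums_to_ge_term 0 _ yE)) => [|k];
  by rewrite mulr_ge0// (tf_ge0 P_tf).
Qed.

(** As long as [D] is at least [d], a fixed part of the excess and of the
    deficit sits in a finite set of states, independent of time, from which
    state 0 is reached with a probability bounded below; so [D] loses a fixed
    amount in every unit of time. *)
Let D_small d : 0 < d -> exists n : nat, D n%:R < d.
Proof.
move=> d0; apply: contrapT => nD.
have Dd n : d <= D n%:R.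
  by rewrite leNgt; apply/negP => Dn; apply: nD; exists n.
have pi0 : 0 < (p i)^-1 by rewrite invr_gt0.
have [N HN] : exists N, (p i)^-1 * (1 - \sum_(0 <= k < N) p k) <= d / 2.
  have C : (p i)^-1 * (1 - \sum_(0 <= k < n) p k) @[n --> \oo] -->
      (p i)^-1 * (1 - 1).
    apply: cvgM; first exact: cvg_cst.
    by apply: cvgB; [exact: cvg_cst|exact: p_sum].
  rewrite subrr mulr0 in C.
  have d20 : 0 < d / 2 by rewrite divr_gt0.
  have [N _ HN] := cvgr_le _ C _ d20.
  by exists N; apply: HN => /=.
have [e e0 He] : exists2 e, 0 < e & forall k, (k < N)%N -> e <= P 1 k 0%N.
  elim: (N) => [|n [e e0 He]]; first by exists 1.
  exists (Num.min e (P 1 n 0%N)); first by rewrite lt_min e0 P_gt0.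
  move=> k; rewrite ltnS leq_eqVlt => /predU1P[->|kn]; rewrite ge_min.
    by rewrite lexx orbT.
  by rewrite He.
have reach (a : nat -> R) n x : (forall k, 0 <= a k <= (p i)^-1 * p k) ->
    sums_to a (D n%:R) -> sums_to (fun k => a k * P 1 k 0%N) x ->
    e * (d / 2) <= x.
  move=> ap aD ax.
  have a0 k : 0 <= a k by have /andP[] := ap k.
  have B := sums_to_tail_bounds (N := N) (fun k _ => ap k) aD
    (sums_toZ (p i)^-1 p_sum).
  rewrite mulr1 -mulr_sumr in B; have /andP[_ {}B] := B.
  have aN : d / 2 <= \sum_(0 <= k < N) a k.
    have := Dd n; move: HN B; rewrite mulrBr mulr1.
    move: (\sum_(0 <= _ < N) p _) => w.
    by move: (_^-1 * w) => w'; lra.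
  have aP0 k : 0 <= a k * P 1 k 0%N by rewrite mulr_ge0// (tf_ge0 P_tf).
  apply: le_trans (sums_to_ge_partial N aP0 ax).
  apply: (@le_trans _ _ (e * \sum_(0 <= k < N) a k)); first by rewrite ler_pM2l.
  rewrite mulr_sumr big_nat [leRHS]big_nat; apply: ler_sum => k /andP[_ kN].
  by rewrite mulrC ler_wpM2l// He.
have dec n : D n%:R <= D 0 - e * (d / 2) * n%:R.
  elim: n => [|n IH]; first by rewrite mulr0 subr0.
  have n0 : 0 <= n%:R :> R by [].
  have [x [y [xE yE]]] := D_step n0 ler01.
  have xe : e * (d / 2) <= x.
    apply: (reach _ n _ _ (D_excess n0) xE) => k.
    by rewrite excess_ge0 excess_le.
  have ye : e * (d / 2) <= y.
    apply: (reach _ n _ _ (D_deficit n0) yE) => k.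
    by rewrite deficit_ge0 deficit_le.
  have : e * (d / 2) <= Num.min x y by rewrite le_min xe ye.
  by rewrite -[n.+1%:R]natr1 mulrDr mulr1; lra.
have f0 : 0 < e * (d / 2) by rewrite mulr_gt0// divr_gt0.
pose n := (Num.truncn (D 0 / (e * (d / 2)))).+1.
have : D 0 / (e * (d / 2)) < n%:R by exact: truncnS_gt.
rewrite ltr_pdivrMr// => H.
have := dec n; have := D_ge0 (ler0n R n); lra.
Qed.

(** [D] is nonincreasing in continuous time, so that [D_small], which speaks of
    integer times only, gives the limit. *)
Theorem tf_cvg_invariant j : P t i j @[t --> +oo] --> p j.
Proof.
apply/cvgrPdist_lt => e e0.
have [n Dn] := D_small e0.
near=> t.
have nt : n%:R <= t by near: t; exact: nbhs_pinfty_ge.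
have t0 : 0 <= t by apply: le_trans nt.
have Dt : D t < e.
  apply: le_lt_trans Dn; rewrite -[t](subrKC n%:R).
  by apply: D_nonincreasing; rewrite ?subr_ge0.
have x := sums_to_ge_term j (excess_ge0 t) (D_excess t0).
have y := sums_to_ge_term j (deficit_ge0 t) (D_deficit t0).
rewrite ltr_norml; apply/andP; split.
  apply: lt_le_trans (_ : - excess t j <= _).
    by rewrite ltrN2; exact: le_lt_trans Dt.
  by rewrite lerNl opprB le_max lexx.
apply: le_lt_trans Dt; apply: le_trans y.
by rewrite le_max lexx.
Unshelve. all: by end_near.
Qed.

End From.
End Ergodic.

(** * Tails of the batch rates *)

Section BatchTail.
Variables (R : realType) (b : nat -> R).

(** For [2 <= m] this is the sum of the [b k] over [m <= k], the rate of the
    jumps up by at least [m - 1]: the whole sequence [b] sums to 0. *)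
Definition batch_tail (m : nat) : R := - \sum_(0 <= k < m) b k.

Notation beta := batch_tail.

(** The mean displacement by arrivals per unit time is the sum of
    [(k - 1) * b k] over [2 <= k]; summation by tails turns it into a series
    with these partial sums. *)
Definition partial_drift (n : nat) : R := \sum_(0 <= l < n) beta l.+2.
Notation drift := partial_drift.

Lemma batch_tailS m : beta m.+1 = beta m - b m.
Proof. by rewrite /beta big_nat_recr//= opprD. Qed.

(** An exchange of summations: [k] is below the cuts [j = k + l]. *)
Lemma weighted_cut_sum (g : nat -> R) (s : R) N :
  \sum_(0 <= j < N) s ^+ j * \sum_(1 <= k < j.+1) beta (j - k).+2 * g k =
  \sum_(1 <= k < N) g k * (s ^+ k * \sum_(0 <= l < N - k) beta l.+2 * s ^+ l).
Proof.
elim: N => [|N IH]; first by rewrite !big_geq.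
rewrite big_nat_recr//= IH.
have -> : \sum_(1 <= k < N)
    g k * (s ^+ k * \sum_(0 <= l < N - k) beta l.+2 * s ^+ l) =
  \sum_(1 <= k < N.+1)
    g k * (s ^+ k * \sum_(0 <= l < N - k) beta l.+2 * s ^+ l).
  case: N {IH} => [|N]; first by rewrite !big_geq.
  rewrite [RHS]big_nat_recr//= subnn [X in _ * (_ * X)]big_geq//.
  by rewrite !mulr0 addr0.
rewrite mulr_sumr -big_split/=; apply: eq_big_nat => k /andP[k1 kN].
rewrite subSn// big_nat_recr//= mulrDr mulrDr; congr (_ + _).
have -> : s ^+ N = s ^+ k * s ^+ (N - k) by rewrite -exprD subnKC.
by ring.
Qed.

Lemma cut_sum (g : nat -> R) N :
  \sum_(0 <= j < N) \sum_(1 <= k < j.+1) beta (j - k).+2 * g k =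
  \sum_(1 <= k < N) g k * drift (N - k).
Proof.
have := weighted_cut_sum g 1 N.
under eq_bigr do rewrite expr1n mul1r.
move=> ->; apply: eq_bigr => k _; rewrite expr1n mul1r; congr (_ * _).
by apply: eq_bigr => l _; rewrite expr1n mulr1.
Qed.

Lemma discounted_drift_cvg M :
  \sum_(0 <= l < M) beta l.+2 * s ^+ l.+1 @[s --> 1^'-] --> drift M.
Proof.
have -> : drift M = \sum_(0 <= l < M) beta l.+2 * 1 ^+ l.+1.
  by apply: eq_bigr => l _; rewrite expr1n mulr1.
apply: cvg_sum_nat => l _; apply: cvgM; first exact: cvg_cst.
by apply: cvg_at_left_filter; exact: exprn_continuous.
Qed.

Lemma exists_discount (x : R) M : x < drift M ->
  exists s, [/\ 0 < s, s < 1 &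
    x < \sum_(0 <= l < M) beta l.+2 * s ^+ l.+1].
Proof.
move=> HM; near (1 : R)^'- => s; exists s; split; near: s.
- exact: nbhs_left_gt.
- exact: nbhs_left_lt.
- exact: (cvgr_gt _ (@discounted_drift_cvg M)).
Unshelve. all: by end_near.
Qed.

(** By parts: the coefficients of [B] sum to 0, and this carries out the
    division of [B] by [1 - s] on the partial sums. *)
Lemma generating_partial_sum (s : R) n :
  \sum_(0 <= j < n) b j * s ^+ j =
  (1 - s) * - \sum_(0 <= j < n) beta j.+1 * s ^+ j - s ^+ n * beta n.
Proof.
elim: n => [|n IH].
  by rewrite !big_geq// /beta big_geq// !oppr0 !mulr0 subr0.
by rewrite !big_nat_recr//= IH batch_tailS exprS; ring.
Qed.

Hypothesis b_ge0 : forall j, j != 1%N -> 0 <= b j.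
Hypothesis b_conservative :
  (\sum_(0 <= j <oo | j != 1%N) (b j)%:E)%E = (- b 1%N)%:E.

Lemma batch_sums_to_0 : sums_to b 0.
Proof.
have a0 k : 0 <= (if k != 1%N then b k else 0).
  by case: ifP => [/b_ge0|].
have S : sums_to (fun k => if k != 1%N then b k else 0) (- b 1%N).
  apply/sums_toP => //; rewrite -b_conservative [RHS]eseries_mkcond.
  by apply: eq_eseriesr => k _; case: ifP.
have := sums_toD S (sums_to_delta 1 (b 1%N)); rewrite addNr.
apply: cvg_trans; apply: near_eq_cvg; near=> n => /=.
apply: eq_bigr => k _; have [->|_] := eqVneq k 1%N.
  by rewrite add0r mulr1.
by rewrite mulr0 addr0.
Unshelve. all: by end_near.
Qed.

Lemma batch_tail_ge0 m : (2 <= m)%N -> 0 <= beta m.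
Proof.
move=> m2; rewrite oppr_ge0; apply: (cvgr_to_ge batch_sums_to_0).
near=> n; have mn : (m <= n)%N by near: n; exact: nbhs_infty_ge.
rewrite (big_cat_nat (leq0n _) mn)//= lerDl big_nat sumr_ge0// => k /andP[mk _].
by apply: b_ge0; lia.
Unshelve. all: by end_near.
Qed.

Lemma batch_tail_cvg0 : beta m @[m --> \oo] --> 0.
Proof. by rewrite -oppr0; apply: cvgN; exact: batch_sums_to_0. Qed.

Lemma batch_tail_le2 m : (2 <= m)%N -> beta m <= beta 2.
Proof.
move=> m2; rewrite /beta lerN2 (big_cat_nat (leq0n 2) m2)/= lerDl big_nat.
by apply: sumr_ge0 => k /andP[k2 _]; apply: b_ge0; lia.
Qed.

Lemma partial_drift_ge0 n : 0 <= drift n.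
Proof. by apply: sumr_ge0 => l _; exact: batch_tail_ge0. Qed.

Lemma partial_drift_nondecreasing (m n : nat) :
  (m <= n)%N -> drift m <= drift n.
Proof.
move=> mn; rewrite /partial_drift (big_cat_nat (leq0n _) mn)//= lerDl.
by apply: sumr_ge0 => l _; exact: batch_tail_ge0.
Qed.

Section GeneratingFunction.
Variable c : nat.

Lemma discounted_tails_summable (s : R) : 0 < s -> s < 1 ->
  exists A, sums_to (fun l => beta l.+2 * s ^+ l.+1) A.
Proof.
move=> s0 s1; have sk k : 0 <= s ^+ k by rewrite exprn_ge0// ltW.
have t0 l : 0 <= beta l.+2 * s ^+ l.+1 by rewrite mulr_ge0 ?batch_tail_ge0.
apply: (@sums_to_exists _ _ (beta 2 / (1 - s))) => // n.
apply: (@le_trans _ _ (\sum_(0 <= l < n) beta 2 * s ^+ l)).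
  apply: ler_sum => l _; apply: ler_pM => //; first exact: batch_tail_ge0.
    exact: batch_tail_le2.
  by rewrite exprS ler_piMl// ltW.
rewrite -mulr_sumr ler_wpM2l ?batch_tail_ge0//.
rewrite -(ler_pM2l (_ : 0 < 1 - s)) ?subr_gt0// mulfV ?gt_eqF ?subr_gt0//.
by rewrite big_mkord -opprB mulNr -subrX1 opprB gerBl.
Qed.

Lemma gen_Bc_difference_quotient (s A : R) : 0 < s -> s < 1 ->
  sums_to (fun l => beta l.+2 * s ^+ l.+1) A ->
  (gen_Bc c b s - gen_Bc c b 1) / (s - 1) = A - c%:R * b 0%N.
Proof.
move=> s0 s1 SA.
have B1 : gen_B b 1 = 0.
  apply: cvg_lim => //; have := batch_sums_to_0.
  apply: cvg_trans; apply: near_eq_cvg; apply: nearW => n /=.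
  by apply: eq_bigr => j _; rewrite expr1n mulr1.
have Bs : gen_B b s = (1 - s) * - (- b 0%N + A) - 0 * 0.
  apply: cvg_lim => //; rewrite -cvg_shiftS.
  have C : (1 - s) * - (- b 0%N + \sum_(0 <= l < n) beta l.+2 * s ^+ l.+1)
      - s ^+ n.+1 * beta n.+1 @[n --> \oo] -->
      (1 - s) * - (- b 0%N + A) - 0 * 0.
    apply: cvgB; last first.
      rewrite (cvg_shiftS (fun n => s ^+ n * beta n)).
      apply: cvgM; last exact: batch_tail_cvg0.
      by apply: cvg_expr; rewrite gtr0_norm.
    apply: cvgM; first exact: cvg_cst.
    by apply: cvgN; apply: cvgD; [exact: cvg_cst|exact: SA].
  apply: cvg_trans C; apply: near_eq_cvg; apply: nearW => n /=.
  rewrite /series/= generating_partial_sum; congr (_ * - _ - _).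
  rewrite big_nat_recl//= expr0 mulr1; congr (_ + _).
  by rewrite /beta big_nat1.
rewrite /gen_Bc B1 Bs mul0r !subr0 subrr mulr0 addr0.
have s10 : s - 1 != 0 by rewrite subr_eq0 lt_eqF.
by apply: (mulIf s10); rewrite divfK//; ring.
Qed.

Definition total_drift : \bar R := (\sum_(0 <= l <oo) (beta l.+2)%:E)%E.

Lemma total_drift_leP r :
  (total_drift <= r%:E)%E <-> forall n, drift n <= r.
Proof.
have B0 l : (0 <= (beta l.+2)%:E)%E by rewrite lee_fin batch_tail_ge0.
split=> [H n|H].
  rewrite -lee_fin; apply: le_trans H; rewrite -sumEFin.
  exact: nneseries_lim_ge.
apply: lime_le; first exact: is_cvg_nneseries.
by apply: nearW => n; rewrite sumEFin lee_fin; exact: H.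
Qed.

(** Monotone convergence in [gen_Bc_difference_quotient] as [s] increases to 1;
    the value may be [+oo]. *)
Lemma gen_Bc_left_derivative :
  is_left_derivative (gen_Bc c b) 1 (total_drift - (c%:R * b 0%N)%:E)%E.
Proof.
have upper s A r : 0 < s -> s < 1 -> (forall n, drift n <= r) ->
    sums_to (fun l => beta l.+2 * s ^+ l.+1) A -> A <= r.
  move=> s0 s1 dr SA; apply: (sums_to_le _ SA) => n.
  apply: le_trans (dr n); apply: ler_sum => l _.
  by rewrite ler_piMr ?batch_tail_ge0// exprn_ile1// ltW.
have lower v n : v < drift n -> \forall s \near 1^'-,
    v - c%:R * b 0%N <= (gen_Bc c b s - gen_Bc c b 1) / (s - 1).
  move=> vn; near=> s.
  have s0 : 0 < s by near: s; exact: nbhs_left_gt.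
  have s1 : s < 1 by near: s; exact: nbhs_left_lt.
  have [A SA] := discounted_tails_summable s0 s1.
  rewrite (gen_Bc_difference_quotient s0 s1 SA) lerD2r.
  have t0 l : 0 <= beta l.+2 * s ^+ l.+1.
    by rewrite mulr_ge0 ?batch_tail_ge0// exprn_ge0// ltW.
  apply: le_trans (sums_to_ge_partial n t0 SA); apply/ltW.
  near: s; exact: (cvgr_gt _ (@discounted_drift_cvg n)).
have td0 : (0 <= total_drift)%E.
  by apply: nneseries_ge0 => l _ _; rewrite lee_fin batch_tail_ge0.
case tdE : total_drift td0 => [r| |]// _.
- have dr : forall n, drift n <= r by apply/total_drift_leP; rewrite tdE.
  have Sr : sums_to (fun l => beta l.+2) r.
    by apply/sums_toP => // l; exact: batch_tail_ge0.
  apply: cvg_EFin; first exact: nearW.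
  apply/cvgrPdist_le => e e0 /=.
  have re : r - e < r by rewrite ltrBlDr ltrDl.
  have [n _ /(_ n (leqnn n)) rn] := cvgr_gt _ Sr _ re.
  near=> s.
  have s0 : 0 < s by near: s; exact: nbhs_left_gt.
  have s1 : s < 1 by near: s; exact: nbhs_left_lt.
  have lo : r - e - c%:R * b 0%N <= (gen_Bc c b s - gen_Bc c b 1) / (s - 1).
    by near: s; exact: lower rn.
  have [A SA] := discounted_tails_summable s0 s1.
  have Ar := upper _ _ _ s0 s1 dr SA.
  move: lo; rewrite (gen_Bc_difference_quotient s0 s1 SA).
  by rewrite ler_norml => ?; apply/andP; split; lra.
- rewrite addye//; apply/cvgeyPge => v.
  have [n vn] : exists n, v + c%:R * b 0%N < drift n.
    apply: contrapT => nn.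
    have : (total_drift <= (v + c%:R * b 0%N)%:E)%E.
      apply/total_drift_leP => n; rewrite leNgt; apply/negP => vn.
      by apply: nn; exists n.
    by rewrite tdE.
  near=> s; rewrite lee_fin.
  have : v + c%:R * b 0%N - c%:R * b 0%N <=
      (gen_Bc c b s - gen_Bc c b 1) / (s - 1) by near: s; exact: lower vn.
  by rewrite addrK.
Unshelve. all: by end_near.
Qed.

Lemma gen_Bc_left_derivative_unique (l : \bar R) :
  is_left_derivative (gen_Bc c b) 1 l ->
  l = (total_drift - (c%:R * b 0%N)%:E)%E.
Proof.
move=> Dl; apply: (cvg_unique _ Dl gen_Bc_left_derivative).
exact: ereal_hausdorff.
Qed.

Lemma left_derivative_le0P :
  (exists2 l, is_left_derivative (gen_Bc c b) 1 l & (l <= 0)%E) <->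
  forall n, drift n <= c%:R * b 0%N.
Proof.
rewrite -total_drift_leP; split=> [[l /gen_Bc_left_derivative_unique ->]|H].
  by rewrite leeBlDr// add0e.
exists (total_drift - (c%:R * b 0%N)%:E)%E; first exact: gen_Bc_left_derivative.
by rewrite leeBlDr// add0e.
Qed.

Lemma left_derivative_lt0P :
  (exists2 l, is_left_derivative (gen_Bc c b) 1 l & (l < 0)%E) <->
  (exists2 r, r < c%:R * b 0%N & forall n, drift n <= r).
Proof.
split=> [[l /gen_Bc_left_derivative_unique ->]|[r rc dr]].
  rewrite lteBlDr// add0e.
  have td0 : (0 <= total_drift)%E.
    by apply: nneseries_ge0 => l' _ _; rewrite lee_fin batch_tail_ge0.
  case tdE : total_drift td0 => [r| |]// _; rewrite lte_fin => rc.
  by exists r => //; apply/total_drift_leP; rewrite tdE.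
exists (total_drift - (c%:R * b 0%N)%:E)%E; first exact: gen_Bc_left_derivative.
rewrite lteBlDr// add0e.
apply: (@le_lt_trans _ _ r%:E); last by rewrite lte_fin.
exact/total_drift_leP.
Qed.

End GeneratingFunction.

Hypothesis b_arrivals : (0 < \sum_(2 <= j <oo) (b j)%:E)%E.

Lemma batch_tail2_gt0 : 0 < beta 2.
Proof.
rewrite lt_neqAle batch_tail_ge0// andbT eq_sym; apply/eqP => beta2.
move: b_arrivals; rewrite ltNge => /negP; apply.
apply: lime_le.
  by apply: is_cvg_nneseries => k k2 _; rewrite lee_fin b_ge0//; lia.
near=> n; have n2 : (2 <= n)%N by near: n; exact: nbhs_infty_ge.
rewrite sumEFin lee_fin.
have := batch_tail_ge0 n2; rewrite /beta (big_cat_nat (leq0n 2) n2)/= opprD.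
by move: beta2; rewrite /beta => ->; rewrite add0r oppr_ge0.
Unshelve. all: by end_near.
Qed.

End BatchTail.

(** * Tails of the resurrection rates *)

Section ResurrectionTail.
Variables (R : realType) (h : nat -> R).

Definition resurrection_tail (m : nat) : R :=
  fine (resurrection_rate h) - \sum_(1 <= k < m) h k.

Notation eta := resurrection_tail.

Lemma resurrection_tailS m : (1 <= m)%N -> eta m.+1 = eta m - h m.
Proof. by move=> m1; rewrite /eta big_nat_recr//= opprD addrA. Qed.

Lemma resurrection_partial_mean N :
  \sum_(1 <= j < N.+1) j%:R * h j =
  \sum_(0 <= j < N) (eta j.+1 - eta N.+1).
Proof.
rewrite sumrB sumr_const_nat subn0 -[eta _ *+ _]mulr_natl.
elim: N => [|N IH]; first by rewrite !big_geq// mul0r subr0.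
rewrite big_nat_recr//= IH [X in _ = X - _]big_nat_recr//=.
have -> : N.+1%:R = N%:R + 1 :> R by rewrite natr1.
by rewrite (resurrection_tailS (ltn0Sn N)); ring.
Qed.

Hypothesis h_ge0 : forall j, (1 <= j)%N -> 0 <= h j.

Lemma resurrection_tail_nonincreasing (m n : nat) :
  (1 <= m)%N -> (m <= n)%N -> eta n <= eta m.
Proof.
move=> m1 mn; rewrite /eta lerD2l lerN2 (big_cat_nat m1 mn)/= lerDl big_nat.
by apply: sumr_ge0 => k /andP[mk _]; apply: h_ge0; lia.
Qed.

Hypothesis h_fin : (resurrection_rate h < +oo)%E.

Lemma resurrection_rate_fin : resurrection_rate h \is a fin_num.
Proof.
rewrite ge0_fin_numE//; apply: nneseries_ge0 => j j1 _.
by rewrite lee_fin h_ge0.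
Qed.

Lemma resurrection_tail_cvg0 : eta m @[m --> \oo] --> 0.
Proof.
have H : (fun n => \sum_(1 <= i < n) (h i)%:E)%E @ \oo --> resurrection_rate h.
  apply: (@is_cvg_nneseries _ (EFin \o h) xpredT 1).
  by move=> k k1 _; rewrite lee_fin h_ge0.
rewrite -(subrr (fine (resurrection_rate h))).
apply: cvgB; first exact: cvg_cst.
rewrite -(fineK resurrection_rate_fin) in H.
have {}H := fine_cvg H.
have <- : fine \o (fun n => \sum_(1 <= i < n) (h i)%:E)%E =
    (fun n => \sum_(1 <= i < n) h i) by apply/funext => n /=; rewrite sumEFin.
exact: H.
Qed.

Lemma resurrection_tail_ge0 m : (1 <= m)%N -> 0 <= eta m.
Proof.
move=> m1; apply: (cvgr_to_le resurrection_tail_cvg0).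
near=> n; have mn : (m <= n)%N by near: n; exact: nbhs_infty_ge.
rewrite /eta lerD2l lerN2 (big_cat_nat m1 mn)//= lerDl big_nat sumr_ge0//.
by move=> k /andP[mk _]; apply: h_ge0; lia.
Unshelve. all: by end_near.
Qed.

(** The mean is the sum of the tails. The boundary term [M * eta M.+1] of the
    summation by parts is kept inside the sum, where it is harmless for a fixed
    number [N] of terms as [M] tends to infinity. *)
Lemma resurrection_mean_finP : (resurrection_mean h < +oo)%E <->
  exists nu, forall N, \sum_(0 <= j < N) eta j.+1 <= nu.
Proof.
have H0 j : (1 <= j)%N -> xpredT j -> (0 <= (j%:R * h j)%:E)%E.
  by move=> j1 _; rewrite lee_fin mulr_ge0// h_ge0.
split=> [fin|[nu en]].
- have mf : resurrection_mean h \is a fin_num.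
    by rewrite ge0_fin_numE//; exact: nneseries_ge0.
  exists (fine (resurrection_mean h)) => N.
  have C : \sum_(0 <= j < N) (eta j.+1 - eta M.+1) @[M --> \oo] -->
      \sum_(0 <= j < N) (eta j.+1 - 0).
    apply: cvg_sum_nat => j _; apply: cvgB; first exact: cvg_cst.
    rewrite (cvg_shiftS eta); exact: resurrection_tail_cvg0.
  have E : \sum_(0 <= j < N) (eta j.+1 - 0) = \sum_(0 <= j < N) eta j.+1.
    by apply: eq_bigr => j _; rewrite subr0.
  rewrite E in C.
  apply: (cvgr_to_le C); near=> M.
  have NM : (N <= M)%N by near: M; exact: nbhs_infty_ge.
  apply: (@le_trans _ _ (\sum_(1 <= j < M.+1) j%:R * h j)).
    rewrite resurrection_partial_mean (big_cat_nat (leq0n N) NM)/= lerDl.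
    rewrite big_nat; apply: sumr_ge0 => j /andP[_ jM].
    by rewrite subr_ge0 resurrection_tail_nonincreasing// ltnW.
  rewrite -lee_fin fineK// -sumEFin; exact: nneseries_lim_ge.
- apply: (@le_lt_trans _ _ nu%:E); last exact: ltry.
  apply: lime_le; first exact: is_cvg_nneseries.
  near=> n; have n0 : (0 < n)%N by near: n; exact: nbhs_infty_gt.
  rewrite sumEFin lee_fin -(prednK n0) resurrection_partial_mean.
  apply: le_trans (en n.-1); apply: ler_sum => j _.
  by rewrite gerBl resurrection_tail_ge0.
Unshelve. all: by end_near.
Qed.

(** The tails tend to 0, and so do their averages. *)
Lemma resurrection_tail_sublinear (K e : R) : 0 <= K -> 0 < e ->
  exists C, forall N, K * \sum_(0 <= j < N) eta j.+1 <= C + e * N%:R.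
Proof.
move=> K0 e0.
have e1 : 0 < e / (K + 1) by rewrite divr_gt0// ltr_wpDl.
have : \forall m \near \oo, eta m <= e / (K + 1).
  exact: (cvgr_le _ resurrection_tail_cvg0).
move=> [J _ HJ].
exists (K * \sum_(0 <= j < J) eta j.+1) => N.
have H j : (J <= j)%N -> K * eta j.+1 <= e.
  move=> Jj; have := HJ j.+1 (leqW Jj); rewrite /= ler_pdivlMr ?ltr_wpDl//.
  have := resurrection_tail_ge0 (ltn0Sn j); lra.
have S0 m n : 0 <= \sum_(m <= j < n) eta j.+1.
  by apply: sumr_ge0 => j _; exact: resurrection_tail_ge0.
have [NJ|JN] := leqP N J.
  rewrite [X in _ <= _ * X + _](big_cat_nat (leq0n N) NJ)/= mulrDr -addrA lerDl.
  by rewrite addr_ge0// mulr_ge0// ltW.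
rewrite [X in _ * X <= _](big_cat_nat (leq0n J) (ltnW JN))/= mulrDr lerD2l.
apply: (@le_trans _ _ (\sum_(J <= j < N) e)).
  rewrite mulr_sumr big_nat [leRHS]big_nat; apply: ler_sum => j /andP[Jj _].
  exact: H.
rewrite sumr_const_nat -[_ *+ _]mulr_natr ler_pM2l// ler_nat; exact: leq_subr.
Qed.

Hypothesis h_gt0 : (0 < resurrection_rate h)%E.

Lemma resurrection_tail1_gt0 : 0 < eta 1.
Proof. by rewrite /eta big_geq// subr0 fine_gt0// h_gt0. Qed.

End ResurrectionTail.

(** * The rates of the queue *)

Section Queue.
Variables (R : realType) (c : nat) (b h : nat -> R).
Notation beta := (batch_tail b).
Notation eta := (resurrection_tail h).
Notation drift := (partial_drift b).

Definition service_rate (i : nat) : R := (minn i c)%:R * b 0%N.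

Notation delta := service_rate.

(** The balance, for a measure [m] on the states, between the flow from
    [0, j] up into [j + 1, oo) and the flow back down. Since jumps down have
    size one, the latter comes from state [j + 1] alone. *)
Definition cut_balanced (m : nat -> R) : Prop := forall j,
  delta j.+1 * m j.+1 =
  eta j.+1 * m 0%N + \sum_(1 <= k < j.+1) beta (j - k).+2 * m k.

Lemma queue_q_matrix_skip_free k j : (j.+1 < k)%N ->
  queue_q_matrix c b h k j = 0.
Proof.
move=> jk; rewrite /queue_q_matrix.
by rewrite !ifF//; lia.
Qed.

Lemma queue_q_matrix_column0 (g : nat -> R) :
  \sum_(0 <= k < 2) g k * queue_q_matrix c b h k 0 =
  delta 1 * g 1%N - eta 1 * g 0%N.
Proof.
rewrite !big_nat_recr//= big_nil add0r /queue_q_matrix/= /eta big_geq// subr0.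
by rewrite mulrN addrC mulrC [g 0%N * _]mulrC.
Qed.

Lemma queue_q_matrix_column (g : nat -> R) j :
  \sum_(0 <= k < j.+3) g k * queue_q_matrix c b h k j.+1 =
  h j.+1 * g 0%N + \sum_(1 <= k < j.+1) b (j - k).+2 * g k
  + (b 1%N + b 0%N - delta j.+1) * g j.+1 + delta j.+2 * g j.+2.
Proof.
rewrite 2?[\sum_(0 <= k < _.+2) _]big_nat_recr//= big_ltn//.
congr (_ + _ + _ + _).
- by rewrite /queue_q_matrix/= mulrC.
- apply: eq_big_nat => k /andP[k1 kj].
  have [k0 jk1] : (k == 0%N) = false /\ (j.+1 == k.-1) = false by lia.
  have [jk kj1] : (j.+1 == k) = false /\ (k < j.+1)%N by lia.
  rewrite /queue_q_matrix k0 jk1 jk kj1.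
  by rewrite mulrC; congr (b _ * _); lia.
- rewrite /queue_q_matrix/= ifF; last by apply/eqP; lia.
  by rewrite eqxx mulrC /delta; congr (_ * _); ring.
- by rewrite /queue_q_matrix/= eqxx mulrC.
Qed.

Hypothesis c_ge1 : (1 <= c)%N.
Hypothesis b_ge0 : forall j, j != 1%N -> 0 <= b j.
Hypothesis b_conservative :
  (\sum_(0 <= j <oo | j != 1%N) (b j)%:E)%E = (- b 1%N)%:E.
Hypothesis b0_gt0 : 0 < b 0%N.
Hypothesis b_arrivals : (0 < \sum_(2 <= j <oo) (b j)%:E)%E.
Hypothesis h_ge0 : forall j, (1 <= j)%N -> 0 <= h j.
Hypothesis h_gt0 : (0 < resurrection_rate h)%E.
Hypothesis h_fin : (resurrection_rate h < +oo)%E.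

Lemma service_rate_gt0 i : 0 < delta i.+1.
Proof. by rewrite mulr_gt0// ltr0n leq_min. Qed.

Lemma service_rate_ge0 i : 0 <= delta i.
Proof. by rewrite mulr_ge0// ltW. Qed.

Lemma service_rate_le i : delta i <= c%:R * b 0%N.
Proof. by rewrite ler_pM2r// ler_nat geq_minr. Qed.

Lemma service_rate_max i : (c <= i)%N -> delta i = c%:R * b 0%N.
Proof. by move=> ci; rewrite /delta (minn_idPr ci). Qed.

(** Replacing the service rate by its maximum costs something only in the
    finitely many states where some server is idle. *)
Lemma service_sum_ge (g : nat -> R) N : (forall k, 0 <= g k) ->
  \sum_(1 <= k < N) c%:R * b 0%N * g k - \sum_(0 <= j < N) delta j.+1 * g j.+1
  <= \sum_(1 <= k < c) c%:R * b 0%N * g k.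
Proof.
move=> g0; have cb : 0 <= c%:R * b 0%N by rewrite mulr_ge0// ltW.
have -> : \sum_(0 <= j < N) delta j.+1 * g j.+1 =
    \sum_(1 <= k < N.+1) delta k * g k by rewrite big_add1.
have le1 : \sum_(1 <= k < N) delta k * g k <=
    \sum_(1 <= k < N.+1) delta k * g k.
  case: N => [|N]; first by rewrite !big_geq.
  by rewrite [leRHS]big_nat_recr//= lerDl mulr_ge0// service_rate_ge0.
apply: (@le_trans _ _ (\sum_(1 <= k < N) (c%:R * b 0%N - delta k) * g k)).
  by under [leRHS]eq_bigr do rewrite mulrBl; rewrite sumrB; lra.
have [Nc|cN] := leqP N c.
  have [N1|N1] := leqP 1 N; last first.
    rewrite big_geq ?sumr_ge0//; last by lia.
    by move=> k _; rewrite mulr_ge0.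
  rewrite [leRHS](big_cat_nat N1 Nc)/=; apply: ler_wpDr.
    by apply: sumr_ge0 => k _; rewrite mulr_ge0.
  apply: ler_sum => k _; rewrite ler_wpM2r// gerBl; exact: service_rate_ge0.
rewrite (big_cat_nat c_ge1 (ltnW cN))/=.
rewrite [X in _ + X <= _]big_nat [X in _ + X <= _]big1 ?addr0; last first.
  by move=> k /andP[ck _]; rewrite service_rate_max// subrr mul0r.
apply: ler_sum => k _; rewrite ler_wpM2r// gerBl; exact: service_rate_ge0.
Qed.

Lemma queue_q_matrix_bounded i : - queue_q_matrix c b h i i <=
  fine (resurrection_rate h) + (- b 1%N + c%:R * b 0%N).
Proof.
have h0 : 0 <= fine (resurrection_rate h) by rewrite fine_ge0// ltW.
have b10 : 0 <= - b 1%N.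
  have := batch_tail_ge0 b_ge0 b_conservative (leqnn 2).
  by rewrite /beta !big_nat_recr//= big_nil add0r opprD; have := b0_gt0; lra.
have cb : 0 <= c%:R * b 0%N by rewrite mulr_ge0// ltW.
rewrite /queue_q_matrix; have [_|i0] := eqVneq i 0%N.
  by rewrite opprK; lra.
rewrite ifF ?eqxx; last by apply/eqP; lia.
have : (minn i c)%:R * b 0%N <= c%:R * b 0%N by exact: service_rate_le.
by have := b0_gt0; rewrite mulrBl; lra.
Qed.


(** * Measures balanced across the cuts *)

(** State 1 receives flow from 0, and [j + 1] from [j], as [beta 2 > 0]. *)
Lemma cut_balanced_gt0 (m : nat -> R) : m 0%N = 1 -> cut_balanced m ->
  forall j, 0 < m j.
Proof.
move=> m0 mb; elim/ltn_ind => -[_|j IH]; first by rewrite m0.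
rewrite -(pmulr_lgt0 _ (service_rate_gt0 j)) mulrC mb.
have e0 : 0 <= eta j.+1 * m 0%N.
  by rewrite mulr_ge0 ?(resurrection_tail_ge0 h_ge0 h_fin)// m0.
case: j => [|j] in IH e0 *.
  by rewrite m0 mulr1 big_geq// addr0 (resurrection_tail1_gt0 h_fin h_gt0).
apply: ltr_wpDl => //; rewrite big_nat_recr//= subnn; apply: ltr_wpDl.
  rewrite big_nat; apply: sumr_ge0 => k /andP[_ kj].
  by rewrite mulr_ge0 ?(batch_tail_ge0 b_ge0 b_conservative)// ltW// IH// ltnW.
by rewrite mulr_gt0 ?(batch_tail2_gt0 b_ge0 b_conservative b_arrivals)// IH.
Qed.

Lemma cut_balanced_sum (m : nat -> R) N : m 0%N = 1 -> cut_balanced m ->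
  \sum_(0 <= j < N) delta j.+1 * m j.+1 =
  \sum_(0 <= j < N) eta j.+1 + \sum_(1 <= k < N) m k * drift (N - k).
Proof.
move=> m0 mb; rewrite -cut_sum -big_split/=; apply: eq_bigr => j _.
by rewrite mb m0 mulr1.
Qed.

(** In the sum of the balances over [j < N], the inflow from the positive
    states is at most [r] times their mass, and the outflow is [c * b 0] times
    the mass of all but finitely many of them. *)
Lemma cut_balanced_summable (m : nat -> R) (r nu : R) :
  m 0%N = 1 -> cut_balanced m -> r < c%:R * b 0%N ->
  (forall n, drift n <= r) -> (forall N, \sum_(0 <= j < N) eta j.+1 <= nu) ->
  exists M, sums_to m M.
Proof.
move=> m0 mb rc dr en; have mp := cut_balanced_gt0 m0 mb.
have mw k : 0 <= m k by exact: ltW.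
pose C := \sum_(1 <= k < c) c%:R * b 0%N * m k.
have B N : \sum_(1 <= k < N) m k <= (C + nu) / (c%:R * b 0%N - r).
  rewrite ler_pdivlMr ?subr_gt0// mulrC mulrBl.
  have H1 := service_sum_ge N mw.
  rewrite -mulr_sumr cut_balanced_sum// -/C in H1.
  have H2 : \sum_(1 <= k < N) m k * drift (N - k) <= r * \sum_(1 <= k < N) m k.
    by rewrite mulr_sumr; apply: ler_sum => k _; rewrite mulrC ler_wpM2r.
  by have := en N; lra.
apply: (@sums_to_exists _ _ (1 + (C + nu) / (c%:R * b 0%N - r))) => // -[|N].
  rewrite big_geq// addr_ge0//.
  by have := B 0%N; rewrite big_geq.
by rewrite big_ltn// m0 lerD2l.
Qed.

(** The sum of all the balances is an identity between finite quantities, in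
    which the positive inflow [eta 1] from 0 leaves a gap between
    [c * b 0 * (M - 1)] and the flow [drift n * (M - 1)] caused by arrivals. *)
Lemma drift_lt_of_summable (m : nat -> R) (M : R) :
  m 0%N = 1 -> cut_balanced m -> sums_to m M ->
  (exists2 r, r < c%:R * b 0%N & forall n, drift n <= r) /\
  (exists nu, forall N, \sum_(0 <= j < N) eta j.+1 <= nu).
Proof.
move=> m0 mb mM; have mp := cut_balanced_gt0 m0 mb.
have mw k : 0 <= m k by exact: ltW.
have cb : 0 <= c%:R * b 0%N by rewrite mulr_ge0// ltW.
have part N : \sum_(1 <= k < N.+1) m k <= M - 1.
  by have := sums_to_ge_partial N.+1 mw mM; rewrite big_ltn// m0; lra.
have up N : \sum_(0 <= j < N) eta j.+1 + \sum_(1 <= k < N) m k * drift (N - k)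
    <= c%:R * b 0%N * (M - 1).
  rewrite -cut_balanced_sum//.
  apply: (@le_trans _ _ (c%:R * b 0%N * \sum_(1 <= k < N.+1) m k)); last first.
    by rewrite ler_wpM2l.
  rewrite big_add1 mulr_sumr; apply: ler_sum => k _.
  by rewrite ler_wpM2r ?service_rate_le.
have d0 N : 0 <= \sum_(1 <= k < N) m k * drift (N - k).
  apply: sumr_ge0 => k _.
  by rewrite mulr_ge0 ?(partial_drift_ge0 b_ge0 b_conservative).
split; last first.
  exists (c%:R * b 0%N * (M - 1)) => N; apply: le_trans (up N).
  by rewrite lerDl.
have M1 : 0 < M - 1.
  by apply: lt_le_trans (part 1%N); rewrite big_nat1.
exists (c%:R * b 0%N - eta 1 / (M - 1)).
  by rewrite ltrBlDr ltrDl divr_gt0 ?(resurrection_tail1_gt0 h_fin h_gt0).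
move=> n; rewrite lerBrDr -(ler_pM2r M1) mulrDl divfK ?gt_eqF//.
have C : drift n * (\sum_(0 <= k < K) m k - 1) + eta 1 @[K --> \oo] -->
    drift n * (M - 1) + eta 1.
  apply: cvgD; last exact: cvg_cst.
  apply: cvgM; first exact: cvg_cst.
  by apply: cvgB => //; exact: cvg_cst.
apply: (cvgr_to_le C); near=> K.
have K0 : (0 < K)%N by near: K; exact: nbhs_infty_gt.
rewrite big_ltn// m0 [1 + _]addrC addrK.
apply: le_trans (up (K + n)%N); rewrite addrC; apply: lerD.
  have Kn : (0 < K + n)%N by lia.
  rewrite big_ltn// lerDl; apply: sumr_ge0 => j _.
  exact: (resurrection_tail_ge0 h_ge0 h_fin).
rewrite (big_cat_nat K0 (leq_addr n K))/= mulr_sumr; apply: ler_wpDr.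
  apply: sumr_ge0 => k _.
  by rewrite mulr_ge0 ?(partial_drift_ge0 b_ge0 b_conservative).
rewrite [leLHS]big_nat [leRHS]big_nat; apply: ler_sum => k /andP[_ kK].
rewrite mulrC ler_wpM2l//.
apply: (partial_drift_nondecreasing b_ge0 b_conservative); lia.
Unshelve. all: by end_near.
Qed.

(** * The cut equation *)

Section Chain.
Variable P : R -> nat -> nat -> R.
Hypotheses (P_tf : transition_function P).
Hypothesis P_q : has_q_matrix P (queue_q_matrix c b h).
Notation occ := (occupation P).

(** In the sum of the forward equations over the states up to [j] only the rates
    across the cut between [j] and [j + 1] survive. *)
Lemma cut_equation i j T : 0 <= T ->
  delta j.+1 * occ i j.+1 T =
  eta j.+1 * occ i 0%N T + \sum_(1 <= k < j.+1) beta (j - k).+2 * occ i k T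
  + \sum_(0 <= l < j.+1) P T i l - (i <= j)%N%:R.
Proof.
move=> T0.
have F := forward_equation P_tf P_q queue_q_matrix_bounded
  queue_q_matrix_skip_free i.
elim: j => [|j IH].
  have := F 0%N _ T0; rewrite queue_q_matrix_column0 big_nat1 big_geq// leqn0.
  by lra.
have := F j.+1 _ T0; rewrite queue_q_matrix_column => Fj.
have -> : (i <= j.+1)%N%:R = (i <= j)%N%:R + (i == j.+1)%:R :> R.
  by rewrite -natrD; congr (_%:R); lia.
rewrite [\sum_(0 <= l < j.+2) _]big_nat_recr//=.
rewrite [\sum_(1 <= k < j.+2) _]big_nat_recr//= subnn.
have -> : \sum_(1 <= k < j.+1) beta (j.+1 - k).+2 * occ i k T =
    \sum_(1 <= k < j.+1) beta (j - k).+2 * occ i k T -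
    \sum_(1 <= k < j.+1) b (j - k).+2 * occ i k T.
  rewrite -sumrB; apply: eq_big_nat => k /andP[_ kj].
  by rewrite subSn// batch_tailS mulrBl.
have b2 : beta 2 = - b 1%N - b 0%N.
  by rewrite /beta !big_nat_recr//= big_nil; lra.
rewrite resurrection_tailS// b2; move: IH Fj.
by rewrite !mulrBl !mulrDl !mulNr; lra.
Qed.

Lemma cut_boundary_le1 i j T : 0 <= T ->
  `|\sum_(0 <= l < j.+1) P T i l - (i <= j)%N%:R| <= 1.
Proof.
move=> T0.
have P0 k : 0 <= P T i k by exact: (tf_ge0 P_tf).
have := sums_to_ge_partial j.+1 P0 (tf_sums_to_1 P_tf i T0).
have : 0 <= \sum_(0 <= l < j.+1) P T i l by exact: sumr_ge0.
by rewrite ler_norml; case: (i <= j)%N => /= ? ?; apply/andP; split; lra.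
Qed.

(** * The invariant measure as a limit of ratios of occupation times *)

(** By the cut equation at [j], divided by the time spent in 0, the limits for
    the states up to [j] determine the one for [j + 1]; the boundary terms are
    bounded, hence disappear. *)
Lemma occupation_ratio_cvg i : occ i 0%N T @[T --> +oo] --> +oo ->
  exists m : nat -> R, [/\ m 0%N = 1, cut_balanced m &
    forall j, occ i j T / occ i 0%N T @[T --> +oo] --> m j].
Proof.
move=> occ0.
have occ0_gt K : \forall T \near +oo, K < occ i 0%N T.
  by move/cvgryPgt : occ0; exact.
pose m j := lim (occ i j T / occ i 0%N T @[T --> +oo]).
have ratio0 : occ i 0%N T / occ i 0%N T @[T --> +oo] --> (1 : R).
  apply: cvg_near_cst; near=> T; rewrite divff// gt_eqF//.
  by near: T; exact: occ0_gt.
have m0 : m 0%N = 1 by exact: cvg_lim.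
have step j : (forall k, (k <= j)%N ->
      occ i k T / occ i 0%N T @[T --> +oo] --> m k) ->
    occ i j.+1 T / occ i 0%N T @[T --> +oo] -->
    (eta j.+1 * m 0%N + \sum_(1 <= k < j.+1) beta (j - k).+2 * m k) /
      delta j.+1.
  move=> IH.
  pose L T := \sum_(0 <= l < j.+1) P T i l - (i <= j)%N%:R.
  have L0 : L T / occ i 0%N T @[T --> +oo] --> 0.
    apply/cvgr0Pnorm_le => e e0; near=> T.
    have T0 : 0 <= T by near: T; exact: nbhs_pinfty_ge.
    have oT : e^-1 < occ i 0%N T by near: T; exact: occ0_gt.
    have o0 : 0 < occ i 0%N T by apply: lt_trans oT; rewrite invr_gt0.
    rewrite normrM normfV (gtr0_norm o0) ler_pdivrMr//.
    apply: le_trans (cut_boundary_le1 i j T0) _.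
    by rewrite -ler_pdivrMl// mulr1 ltW.
  have C : (eta j.+1 * (occ i 0%N T / occ i 0%N T) +
      \sum_(1 <= k < j.+1) beta (j - k).+2 * (occ i k T / occ i 0%N T)
      + L T / occ i 0%N T) / delta j.+1 @[T --> +oo] -->
    (eta j.+1 * m 0%N + \sum_(1 <= k < j.+1) beta (j - k).+2 * m k + 0) /
      delta j.+1.
    apply: cvgM; last exact: cvg_cst.
    apply: cvgD => //; apply: cvgD.
      by apply: cvgM; [exact: cvg_cst|exact: IH].
    apply: cvg_sum_nat => k /andP[_ kj].
    by apply: cvgM; [exact: cvg_cst|exact: IH].
  rewrite addr0 in C; apply: cvg_trans C; apply: near_eq_cvg; near=> T => /=.
  have T0 : 0 <= T by near: T; exact: nbhs_pinfty_ge.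
  have d0 := service_rate_gt0 j.
  have E := cut_equation i j T0; rewrite -addrA -/(L T) in E.
  have o0 : occ i 0%N T != 0 by rewrite gt_eqF//; near: T; exact: occ0_gt.
  transitivity (delta j.+1 * occ i j.+1 T / occ i 0%N T / delta j.+1).
    rewrite E; congr (_ / _); move: (L T) (eta j.+1) => w e.
    rewrite 2!mulrDl mulr_suml mulrA; congr (_ + _ + _).
    by apply: eq_bigr => k _; rewrite mulrA.
  by rewrite mulrAC (mulrC (delta _)) mulfK// lt0r_neq0.
have ratio j : occ i j T / occ i 0%N T @[T --> +oo] --> m j.
  elim/ltn_ind: j => -[_|j IH]; first by rewrite m0.
  by apply: cvgP (step j _) => k kj; exact: IH.
exists m; split => // j.
have := step j (fun k _ => ratio k).
move=> /cvg_lim; rewrite -/(m j.+1) => ->//.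
by rewrite mulrC divfK// lt0r_neq0// service_rate_gt0.
Unshelve. all: by end_near.
Qed.

(** The law of the chain at a uniformly distributed time in [0, T] changes
    little under [P s] when [T] is large; dividing by the time spent in 0 and
    letting [T] tend to infinity leaves an inequality by Fatou. *)
Lemma occupation_ratio_subinvariant i (m : nat -> R) s j N : 0 <= s ->
  occ i 0%N T @[T --> +oo] --> +oo ->
  (forall j, occ i j T / occ i 0%N T @[T --> +oo] --> m j) ->
  \sum_(0 <= k < N) m k * P s k j <= m j.
Proof.
move=> s0 o0 om.
have C1 : \sum_(0 <= k < N) (occ i k T / occ i 0%N T) * P s k j @[T --> +oo]
    --> \sum_(0 <= k < N) m k * P s k j.
  by apply: cvg_sum_nat => k _; apply: cvgM; [exact: om|exact: cvg_cst].
have C2 : occ i j T / occ i 0%N T + s / occ i 0%N T @[T --> +oo] -->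
    m j + s * 0.
  apply: cvgD; first exact: om.
  apply: cvgM; first exact: cvg_cst.
  apply: (gtr0_cvgV0 _).2 => //.
  by move/cvgryPgt : (o0); exact.
rewrite mulr0 addr0 in C2; apply: (ler_cvg_to C1 C2); near=> T.
have T0 : 0 <= T by near: T; exact: nbhs_pinfty_ge.
have oT : 0 < occ i 0%N T by near: T; move/cvgryPgt : o0; exact.
rewrite -mulrDl ler_pdivlMr// mulr_suml.
under eq_bigr do rewrite mulrAC divfK ?gt_eqF//.
have oP k : 0 <= occ i k T * P s k j.
  by rewrite mulr_ge0 ?(occupation_ge0 P_tf)// (tf_ge0 P_tf).
have S := occupation_shift P_tf P_q queue_q_matrix_bounded i j s0 T0.
apply: le_trans (sums_to_ge_partial N oP S) _.
have TTs : T <= T + s by rewrite lerDl.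
have H : occ i j (T + s) - occ i j T <= 1 * (T + s - T).
  apply: (occupation_increment_le P_tf P_q queue_q_matrix_bounded) => //.
  move=> t Tt _; apply: (tf_le1 P_tf); exact: le_trans Tt.
have := occupation_ge0 P_tf i j s; lra.
Unshelve. all: by end_near.
Qed.

(** State 1 is entered from 0, and [j + 1] from [j], at positive rates; the
    boundary terms of the cut equations are bounded. *)
Lemma occupation_diverges i j : occ i 0%N T @[T --> +oo] --> +oo ->
  occ i j T @[T --> +oo] --> +oo.
Proof.
move=> o0.
have step k j' (a : R) : 0 < a ->
    (forall T, 0 <= T -> a * occ i k T - 1 <= delta j' * occ i j' T) ->
    0 < delta j' ->
    occ i k T @[T --> +oo] --> +oo -> occ i j' T @[T --> +oo] --> +oo.
  move=> a0 le d0 /cvgryPge ok; apply/cvgryPge => A.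
  near=> T; have T0 : 0 <= T by near: T; exact: nbhs_pinfty_ge.
  rewrite -(ler_pM2l d0); apply: le_trans (le T T0).
  rewrite lerBrDr -ler_pdivrMl//.
  by near: T; exact: ok.
have cut j' T (T0 : 0 <= T) := cut_equation i j' T0.
have bd j' T (T0 : 0 <= T) := cut_boundary_le1 i j' T0.
case: j => [//|j]; elim: j => [|j IH].
  apply: (step 0%N _ (eta 1)) => //; last exact: service_rate_gt0.
    exact: (resurrection_tail1_gt0 h_fin h_gt0).
  move=> T T0; have := bd 0%N T T0.
  rewrite ler_norml cut// [\sum_(1 <= k < 1) _]big_geq//.
  by move=> /andP[? _]; lra.
apply: (step j.+1 _ (beta 2)) => //; last exact: service_rate_gt0.
  exact: (batch_tail2_gt0 b_ge0 b_conservative b_arrivals).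
move=> T T0; have := bd j.+1 T T0; rewrite ler_norml cut// => /andP[H _].
rewrite big_nat_recr//= subnn.
have : 0 <= eta j.+2 * occ i 0%N T.
  by rewrite mulr_ge0 ?(resurrection_tail_ge0 h_ge0 h_fin) ?occupation_ge0.
have : 0 <= \sum_(1 <= k < j.+1) beta (j.+1 - k).+2 * occ i k T.
  apply: sumr_ge0 => k _.
  by rewrite mulr_ge0 ?(batch_tail_ge0 b_ge0 b_conservative) ?occupation_ge0.
by lra.
Unshelve. all: by end_near.
Qed.

(** * Recurrence and transience *)

Lemma occupation_sum_ge i N (v T : R) : 0 <= v -> 0 <= T ->
  (forall t, 0 <= t -> t <= T -> v <= \sum_(0 <= j < N) P t i j) ->
  v * T <= \sum_(0 <= j < N) occ i j T.
Proof.
move=> v0 T0 vP.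
have oE j := occupationE P_tf P_q queue_q_matrix_bounded i j T.
have oM j : measurable_fun `[0, T] (EFin \o (fun t => P t i j)).
  exact: (occupation_measurable P_tf P_q queue_q_matrix_bounded).
rewrite -lee_fin -sumEFin; under eq_bigr do rewrite oE.
rewrite -ge0_integral_sum//; last first.
  move=> j t /=; rewrite in_itv/= => /andP[t0 _].
  by rewrite lee_fin (tf_ge0 P_tf).
rewrite -[X in v * X]subr0 -integral_itv_cst//.
apply: ge0_le_integral => //.
- by apply: emeasurable_sum => j; exact: oM.
- move=> t /=; rewrite in_itv/= => /andP[t0 tT].
  by rewrite sumEFin lee_fin vP.
Qed.

(** If state 0 were occupied for a bounded time, so would every state, by the
    cut equations, and the chain would drift away from any finite set. Then
    each cut with the initial state below it carries a unit net flow upwards;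
    adding the first [N] cuts gives a contradiction for large [N], since the
    mean displacement per unit time is nonpositive in the states [k >= c] and
    the resurrection jumps contribute [o(N)]. *)
Lemma occupation_zero_diverges i : (forall n, drift n <= c%:R * b 0%N) ->
  occ i 0%N T @[T --> +oo] --> +oo.
Proof.
move=> drift_le; apply: contrapT => not_div.
have nd j := occupation_nondecreasing P_tf P_q queue_q_matrix_bounded i j.
have o0 j T : 0 <= occ i j T by exact: (occupation_ge0 P_tf).
have [K0 bd0] : exists K, forall T, 0 <= T -> occ i 0%N T <= K.
  apply: contrapT => nb; apply: not_div; apply/cvgryPge => A.
  have [T [T0 AT]] : exists T, 0 <= T /\ A < occ i 0%N T.
    apply: contrapT => nT; apply: nb; exists A => T T0.
    by rewrite leNgt; apply/negP => AT; apply: nT; exists T.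
  apply: filterS (nbhs_pinfty_ge (num_real T)) => t Tt.
  by apply: (le_trans (ltW AT)); exact: nd.
have [K bd] : exists K : nat -> R, forall j T, 0 <= T -> occ i j T <= K j.
  suff : forall j, exists K, forall T, 0 <= T -> occ i j T <= K.
    by move=> /choice[K HK]; exists K.
  move=> j; elim/ltn_ind: j => -[_|j IH]; first by exists K0.
  have /choice[K HK] : forall k, exists K, (k < j.+1)%N ->
      forall T, 0 <= T -> occ i k T <= K.
    move=> k; have [kj|jk] := ltnP k j.+1; last by exists 0.
    by have [K HK] := IH k kj; exists K.
  exists ((eta j.+1 * K 0%N + \sum_(1 <= k < j.+1) beta (j - k).+2 * K k + 1)
    / delta j.+1) => T T0.
  rewrite ler_pdivlMr ?service_rate_gt0// mulrC cut_equation//.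
  rewrite -addrA; apply: lerD; last first.
    by have := cut_boundary_le1 i j T0; rewrite ler_norml => /andP[].
  apply: lerD.
    by rewrite ler_wpM2l ?(resurrection_tail_ge0 h_ge0 h_fin) ?HK.
  rewrite big_nat [leRHS]big_nat; apply: ler_sum => k /andP[_ kj].
  by rewrite ler_wpM2l ?(batch_tail_ge0 b_ge0 b_conservative) ?HK.
have K_ge0 j : 0 <= K j by apply: le_trans (bd j 0 (lexx 0)).
pose C1 := \sum_(1 <= k < c) c%:R * b 0%N * K k.
have main N : N%:R - i%:R <= K 0%N * \sum_(0 <= j < N) eta j.+1 + C1 + 1.
  (* At this time the chain has left the first [N] states, up to a small
     probability. *)
  have [T T0 small] : exists2 T, 0 <= T &
      \sum_(0 <= j < N) P T i j <= N.+1%:R^-1.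
    apply: contrapT => nT.
    pose S := N.+1%:R * (\sum_(0 <= j < N) K j + 1).
    have SK : 0 <= \sum_(0 <= j < N) K j by exact: sumr_ge0.
    have S0 : 0 <= S by rewrite mulr_ge0// addr_ge0.
    have := @occupation_sum_ge i N N.+1%:R^-1 S _ S0.
    rewrite invr_ge0 ler0n mulKf ?pnatr_eq0// => /(_ isT) H.
    have {}H : \sum_(0 <= j < N) K j + 1 <= \sum_(0 <= j < N) occ i j S.
      apply: H => t t0 _; rewrite leNgt; apply/negP => lt.
      by apply: nT; exists t => //; exact: ltW.
    have : \sum_(0 <= j < N) occ i j S <= \sum_(0 <= j < N) K j.
      by apply: ler_sum => j _; exact: bd.
    by lra.
  have E : \sum_(0 <= j < N) (i <= j)%N%:R =
      \sum_(0 <= j < N) eta j.+1 * occ i 0%N T +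
      \sum_(1 <= k < N) occ i k T * drift (N - k) +
      \sum_(0 <= j < N) \sum_(0 <= l < j.+1) P T i l -
      \sum_(0 <= j < N) delta j.+1 * occ i j.+1 T.
    rewrite -cut_sum -!big_split/= -sumrB; apply: eq_bigr => j _.
    by rewrite (cut_equation i j T0); lra.
  have Ei : N%:R - i%:R <= \sum_(0 <= j < N) (i <= j)%N%:R :> R.
    elim: (N) => [|n IH]; first by rewrite big_geq// sub0r oppr_le0.
    rewrite big_nat_recr//= -natr1; case: leqP => ni /=; first by lra.
    rewrite addr0; apply: le_trans (_ : 0 <= _); last exact: sumr_ge0.
    by rewrite natr1 subr_le0 ler_nat.
  have H1 : \sum_(0 <= j < N) eta j.+1 * occ i 0%N T <=
      K 0%N * \sum_(0 <= j < N) eta j.+1.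
    rewrite -mulr_suml mulrC ler_wpM2r ?bd//.
    by apply: sumr_ge0 => j _; exact: (resurrection_tail_ge0 h_ge0 h_fin).
  have H2 : \sum_(1 <= k < N) occ i k T * drift (N - k) <=
      \sum_(1 <= k < N) c%:R * b 0%N * occ i k T.
    by apply: ler_sum => k _; rewrite mulrC ler_wpM2r.
  have H3 := service_sum_ge N (o0 ^~ T).
  have H4 : \sum_(1 <= k < c) c%:R * b 0%N * occ i k T <= C1.
    apply: ler_sum => k _; rewrite ler_wpM2l ?bd//.
    by rewrite mulr_ge0// ltW.
  have H5 : \sum_(0 <= j < N) \sum_(0 <= l < j.+1) P T i l <= 1.
    apply: (@le_trans _ _ (\sum_(0 <= j < N) N.+1%:R^-1)).
      rewrite big_nat [leRHS]big_nat; apply: ler_sum => j /andP[_ jN].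
      apply: le_trans small; rewrite [leRHS](big_cat_nat (leq0n _) jN)/= lerDl.
      by apply: sumr_ge0 => l _; exact: (tf_ge0 P_tf).
    rewrite sumr_const_nat subn0 -[_ *+ _]mulr_natl ler_pdivrMr ?ltr0n// mul1r.
    by rewrite ler_nat.
  by lra.
have half0 : 0 < 2^-1 :> R by rewrite invr_gt0.
have [C HC] := resurrection_tail_sublinear h_ge0 h_fin (K_ge0 0%N) half0.
pose A := C + C1 + 1 + i%:R.
pose N := (Num.truncn (2 * A)).+1.
have NA : 2 * A < N%:R by exact: truncnS_gt.
have := main N; have := HC N; rewrite /A in NA; lra.
Qed.

(** For [s < 1] close to 1 the function [s ^+ j] is superharmonic, strictly so
    at the positive states, so the expected total time spent in one of them is
    finite. Summing [s ^+ j] times the cut equation over [j < N] is a truncated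
    form of this argument; the tails [beta l.+2] with [l >= M] are dropped, and
    with [N = M + n.+1] the error is at most [c * b 0 * T * s ^+ n.+1]. *)
Lemma occupation_one_bounded i M : c%:R * b 0%N < drift M ->
  exists K, forall T, 0 <= T -> occ i 1%N T <= K.
Proof.
move=> /exists_discount[s [s0 s1]]; set phi := \sum_(0 <= _ < M) _ => Hphi.
pose eps := phi - c%:R * b 0%N.
have eps0 : 0 < eps by rewrite subr_gt0.
exists ((1 - s)^-1 / eps) => T T0; rewrite ler_pdivlMr// mulrC.
have cb : 0 <= c%:R * b 0%N by rewrite mulr_ge0// ltW.
have o0 j : 0 <= occ i j T by exact: (occupation_ge0 P_tf).
have sk k : 0 <= s ^+ k by rewrite exprn_ge0// ltW.
have main n : eps * occ i 1%N T <= c%:R * b 0%N * T * s ^+ n.+1 + (1 - s)^-1.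
  pose N := (M + n.+1)%N.
  pose w k := s ^+ k.-1 * occ i k T.
  have w0 k : 0 <= w k by rewrite mulr_ge0.
  have E : \sum_(0 <= j < N) s ^+ j * (delta j.+1 * occ i j.+1 T) =
      \sum_(0 <= j < N) s ^+ j * (eta j.+1 * occ i 0%N T) +
      \sum_(1 <= k < N) occ i k T *
        (s ^+ k * \sum_(0 <= l < N - k) beta l.+2 * s ^+ l) +
      \sum_(0 <= j < N) s ^+ j * (\sum_(0 <= l < j.+1) P T i l) -
      \sum_(0 <= j < N) s ^+ j * (i <= j)%N%:R.
    rewrite -weighted_cut_sum -!big_split/= -sumrB; apply: eq_bigr => j _.
    by rewrite (cut_equation i j T0) !mulrDr mulrN.
  have H1 : 0 <= \sum_(0 <= j < N) s ^+ j * (eta j.+1 * occ i 0%N T).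
    apply: sumr_ge0 => j _.
    by rewrite !mulr_ge0 ?(resurrection_tail_ge0 h_ge0 h_fin).
  have H2 : 0 <= \sum_(0 <= j < N) s ^+ j * (\sum_(0 <= l < j.+1) P T i l).
    apply: sumr_ge0 => j _; rewrite mulr_ge0// sumr_ge0// => l _.
    exact: (tf_ge0 P_tf).
  have H3 : \sum_(0 <= j < N) s ^+ j * (i <= j)%N%:R <= (1 - s)^-1.
    apply: (@le_trans _ _ (\sum_(0 <= j < N) s ^+ j)).
      by apply: ler_sum => j _; rewrite ler_piMr//; case: leqP.
    rewrite -(ler_pM2l (_ : 0 < 1 - s)) ?subr_gt0// mulfV ?gt_eqF ?subr_gt0//.
    by rewrite big_mkord -opprB mulNr -subrX1 opprB gerBl.
  have H4 : phi * \sum_(1 <= k < n.+2) w k <=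
      \sum_(1 <= k < N) occ i k T *
        (s ^+ k * \sum_(0 <= l < N - k) beta l.+2 * s ^+ l).
    apply: (@le_trans _ _ (\sum_(1 <= k < n.+2) occ i k T *
        (s ^+ k * \sum_(0 <= l < N - k) beta l.+2 * s ^+ l))).
      rewrite mulr_sumr big_nat [leRHS]big_nat.
      apply: ler_sum => k /andP[k1 kn].
      have -> : s ^+ k = s ^+ k.-1 * s by rewrite -exprSr prednK.
      have -> : phi * w k = occ i k T * (s ^+ k.-1 * phi) by rewrite /w; ring.
      rewrite ler_wpM2l// -mulrA ler_wpM2l//.
      have MN : (M <= N - k)%N by rewrite -addnBA ?leq_addr.
      rewrite mulr_sumr (big_cat_nat (leq0n M) MN)/=; apply: ler_wpDr.
        apply: sumr_ge0 => l _.
        by rewrite !mulr_ge0 ?(batch_tail_ge0 b_ge0 b_conservative)// ltW.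
      by apply: ler_sum => l _; rewrite exprS mulrCA.
    have [M0|M0] := posnP M.
      move: Hphi; rewrite /phi M0 big_geq// => /(le_lt_trans cb).
      by rewrite ltxx.
    have nN : (n.+2 <= N)%N by rewrite -[n.+2]add1n leq_add2r.
    rewrite [leRHS](big_cat_nat (ltn0Sn n.+1) nN)/= lerDl.
    apply: sumr_ge0 => k _.
    rewrite !mulr_ge0// sumr_ge0// => l _.
    by rewrite mulr_ge0 ?(batch_tail_ge0 b_ge0 b_conservative).
  have H5 : \sum_(0 <= j < N) s ^+ j * (delta j.+1 * occ i j.+1 T) <=
      c%:R * b 0%N * \sum_(1 <= k < n.+2) w k + c%:R * b 0%N * (s ^+ n.+1 * T).
    have -> : \sum_(0 <= j < N) s ^+ j * (delta j.+1 * occ i j.+1 T) =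
        \sum_(1 <= k < N.+1) delta k * w k.
      by rewrite big_add1; apply: eq_bigr => k _; rewrite /w mulrCA.
    apply: (@le_trans _ _ (\sum_(1 <= k < N.+1) c%:R * b 0%N * w k)).
      by apply: ler_sum => k _; rewrite ler_wpM2r ?service_rate_le.
    have nN : (n.+2 <= N.+1)%N by rewrite ltnS leq_addl.
    rewrite -mulr_sumr -mulrDr ler_wpM2l//.
    rewrite (big_cat_nat (ltn0Sn n.+1) nN)/= lerD2l.
    apply: (@le_trans _ _ (s ^+ n.+1 * \sum_(n.+2 <= k < N.+1) occ i k T)).
      rewrite mulr_sumr big_nat [leRHS]big_nat; apply: ler_sum => k /andP[nk _].
      rewrite /w ler_wpM2r//.
      by apply: ler_wiXn2l; [exact: ltW|exact: ltW|case: (k) nk].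
    rewrite ler_wpM2l//.
    have ocS := occupation_sums_to P_tf P_q queue_q_matrix_bounded i T0.
    apply: le_trans (sums_to_ge_partial N.+1 o0 ocS).
    rewrite (big_cat_nat (leq0n n.+2) nN)/= lerDr.
    exact: sumr_ge0.
  have H6 : eps * occ i 1%N T <= eps * \sum_(1 <= k < n.+2) w k.
    rewrite ler_pM2l// big_ltn// {1}/w expr0 mul1r lerDl.
    exact: sumr_ge0.
  by move: H6; rewrite /eps mulrBl [X in _ <= X]mulrBl; lra.
have C : c%:R * b 0%N * T * s ^+ n.+1 + (1 - s)^-1 @[n --> \oo] -->
    c%:R * b 0%N * T * 0 + (1 - s)^-1.
  apply: cvgD; last exact: cvg_cst.
  apply: cvgM; first exact: cvg_cst.
  rewrite (cvg_shiftS (fun n => s ^+ n)).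
  by apply: cvg_expr; rewrite gtr0_norm.
rewrite mulr0 add0r in C; apply: (cvgr_to_ge C).
by apply: nearW => n; exact: main.
Qed.

Lemma diverges_recurrent_state i : occ i i T @[T --> +oo] --> +oo ->
  recurrent_state P i.
Proof.
move=> /cvgryPge o; apply/eqyP => A _.
have [T /= AT] := filter_ex (o A).
apply: le_trans (_ : (occ i i T)%:E <= _)%E; first by rewrite lee_fin.
exact: (occupation_le_total P_tf P_q queue_q_matrix_bounded).
Qed.

Theorem recurrent_iff_drift_le :
  recurrent P <-> forall n, drift n <= c%:R * b 0%N.
Proof.
split=> [rec n|drift_le i].
- rewrite leNgt; apply/negP => /(occupation_one_bounded 1%N)[K HK].
  have := total_occupation_le P_tf P_q queue_q_matrix_bounded HK.
  by rewrite (rec 1%N).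
- apply: diverges_recurrent_state; apply: occupation_diverges.
  exact: occupation_zero_diverges.
Qed.

(** * Positive recurrence *)

Lemma tf_reach_zero k t : 0 < t -> 0 < P t k 0%N.
Proof.
elim: k t => [|k IH] t t0; first by apply: (tf_diag_gt0 P_tf); exact: ltW.
have t20 : 0 < t / 2 by rewrite divr_gt0.
have := tf_mul_le P_tf k.+1 k 0 (ltW t20) (ltW t20); rewrite -splitr.
apply: lt_le_trans; rewrite mulr_gt0 ?IH//.
apply: (tf_gt0_of_rate P_tf P_q) => //; first by lia.
by rewrite /queue_q_matrix/= eqxx; exact: service_rate_gt0.
Qed.

Lemma summable_positive_recurrent (m : nat -> R) (M : R) :
  recurrent P -> occ 0%N 0%N T @[T --> +oo] --> +oo ->
  m 0%N = 1 -> cut_balanced m ->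
  (forall j, occ 0%N j T / occ 0%N 0%N T @[T --> +oo] --> m j) ->
  sums_to m M -> positive_recurrent P.
Proof.
move=> rec o0 m0 mb om mM i; split; first exact: rec.
have mp := cut_balanced_gt0 m0 mb.
have mw k : 0 <= m k by exact: ltW.
have M0 : 0 < M.
  by apply: lt_le_trans (sums_to_ge_term 0 mw mM); rewrite m0.
have inv t j : 0 <= t -> sums_to (fun k => m k * P t k j) (m j).
  move=> t0; apply: (subinvariant_invariant P_tf t0 mw mM) => l N.
  exact: (occupation_ratio_subinvariant _ _ t0 o0 om).
exists (m i / M); first by rewrite divr_gt0.
apply: (tf_cvg_invariant P_tf (p := fun k => m k / M)).
- by move=> k; rewrite divr_gt0.
- have := sums_toZ M^-1 mM; rewrite mulVf ?gt_eqF//.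
  rewrite (_ : (fun k => _) = fun k => m k / M)//.
  by apply/funext => k; rewrite mulrC.
- move=> t j t0; have := sums_toZ M^-1 (inv t j t0); rewrite mulrC.
  rewrite (_ : (fun k => _) = fun k => m k / M * P t k j)//.
  by apply/funext => k; rewrite mulrCA mulrA.
- by move=> k; exact: tf_reach_zero.
Qed.

(** The time spent in 0 is at least [l / 4 * T] for large [T], and all the
    occupation times together add up to [T]. *)
Lemma positive_recurrent_summable (m : nat -> R) :
  occ 0%N 0%N T @[T --> +oo] --> +oo ->
  (forall j, 0 <= m j) ->
  (forall j, occ 0%N j T / occ 0%N 0%N T @[T --> +oo] --> m j) ->
  positive_recurrent_state P 0 -> exists M, sums_to m M.
Proof.
move=> o0 mw om [_ [l l0 Pl]].
have l20 : 0 < l / 2 by rewrite divr_gt0.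
have l2l : l / 2 < l by lra.
have [T1 [T1r HT1]] := cvgr_gt _ Pl _ l2l.
pose T0 := Num.max 0 (T1 + 1).
have T00 : 0 <= T0 by rewrite le_max lexx.
have HP t : T0 <= t -> l / 2 <= P t 0 0.
  move=> T0t; apply: ltW; apply: HT1; apply: lt_le_trans T0t.
  by rewrite lt_max ltrDl ltr01 orbT.
apply: (@sums_to_exists _ _ (4 / l)) => // N.
have C1 : \sum_(0 <= k < N) occ 0%N k T / occ 0%N 0%N T @[T --> +oo]
    --> \sum_(0 <= k < N) m k.
  by apply: cvg_sum_nat => k _; exact: om.
apply: (cvgr_to_le C1); near=> T.
have TT : 2 * T0 <= T.
  by near: T; apply: nbhs_pinfty_ge; exact: num_real.
have T0T : T0 <= T by lra.
have Tge0 : 0 <= T by lra.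
have oT : 0 < occ 0%N 0%N T by near: T; move/cvgryPgt : o0; exact.
have oc k : 0 <= occ 0 k T by exact: (occupation_ge0 P_tf).
have low : l / 2 * (T - T0) <= occ 0%N 0%N T.
  have := occupation_increment_ge P_tf P_q queue_q_matrix_bounded T00 T0T
    (ltW l20)
    (fun t T0t _ => HP t T0t).
  by have := occupation_ge0 P_tf 0 0 T0; lra.
rewrite -mulr_suml ler_pdivrMr// mulrAC ler_pdivlMr//.
apply: (@le_trans _ _ (T * l)).
  rewrite ler_pM2r//.
  apply: sums_to_ge_partial => //.
  exact: (occupation_sums_to P_tf P_q queue_q_matrix_bounded).
have : l * T0 <= l * (T / 2) by rewrite ler_pM2l//; lra.
by move: low; rewrite mulrBr; lra.
Unshelve. all: by end_near.
Qed.

Theorem positive_recurrent_iff_drift_lt :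
  positive_recurrent P <->
  (exists2 r, r < c%:R * b 0%N & forall n, drift n <= r) /\
  (exists nu, forall N, \sum_(0 <= j < N) eta j.+1 <= nu).
Proof.
split=> [prec|[[r rc dr] [nu en]]].
- have rec : recurrent P by move=> i; have [] := prec i.
  have dle := (recurrent_iff_drift_le).1 rec.
  have o0 := occupation_zero_diverges 0 dle.
  have [m [m0 mb om]] := occupation_ratio_cvg o0.
  have mw k : 0 <= m k by apply/ltW; exact: cut_balanced_gt0.
  have [M mM] := positive_recurrent_summable o0 mw om (prec 0%N).
  exact: drift_lt_of_summable mM.
- have dle n : drift n <= c%:R * b 0%N by apply: le_trans (dr n) (ltW rc).
  have rec := (recurrent_iff_drift_le).2 dle.
  have o0 := occupation_zero_diverges 0 dle.
  have [m [m0 mb om]] := occupation_ratio_cvg o0.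
  have [M mM] := cut_balanced_summable m0 mb rc dr en.
  exact: summable_positive_recurrent mM.
Qed.

End Chain.
End Queue.

Theorem theorem3p2 (R : realType) (c : nat) (b h : nat -> R)
  (c_ge1 : (1 <= c)%N)
  (b_ge0 : forall j, j != 1%N -> 0 <= b j)
  (b1_lt0 : 0 < - b 1%N)
  (b_conservative : (\sum_(0 <= j <oo | j != 1%N) (b j)%:E)%E = (- b 1%N)%:E)
  (b0_gt0 : 0 < b 0%N)
  (b_arrivals : (0 < \sum_(2 <= j <oo) (b j)%:E)%E)
  (h_ge0 : forall j, (1 <= j)%N -> 0 <= h j)
  (h_gt0 : (0 < resurrection_rate h)%E)
  (h_fin : (resurrection_rate h < +oo)%E)
  (P : R -> nat -> nat -> R)
  (P_tf : transition_function P)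
  (P_q : has_q_matrix P (queue_q_matrix c b h)) :
  (recurrent P <->
     exists2 l : \bar R, is_left_derivative (gen_Bc c b) 1 l & (l <= 0)%E)
  /\
  (positive_recurrent P <->
     (exists2 l : \bar R, is_left_derivative (gen_Bc c b) 1 l & (l < 0)%E)
     /\ (resurrection_mean h < +oo)%E).
Proof.
have rec := recurrent_iff_drift_le c_ge1 b_ge0 b_conservative b0_gt0 b_arrivals
  h_ge0 h_gt0 h_fin P_tf P_q.
have prec := positive_recurrent_iff_drift_lt c_ge1 b_ge0 b_conservative b0_gt0
  b_arrivals h_ge0 h_gt0 h_fin P_tf P_q.
have D0 := left_derivative_le0P b_ge0 b_conservative c.
have D1 := left_derivative_lt0P b_ge0 b_conservative c.
have Mean := resurrection_mean_finP h_ge0 h_fin.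
by split; [rewrite rec D0|rewrite prec D1 Mean].
Qed.
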